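(* Let $k$ be a field of characteristic two, let $G=\mathrm{SL}_2$ over $k$, let $T\subset G$ be the diagonal torus and let $N$ be the normalizer of $T$ in $G$. For $r\ge 1$ let $G_r$ be the $r$-th Frobenius kernel of $G$. Then $H^1(G,k[G/N])$ is not the inverse limit of the $H^1(G_r,k[G/N])$; that is, the canonical map $$H^1(G,k[G/N])\longrightarrow \varprojlim_{r\ge 1} H^1(G_r,k[G/N])$$ induced by the restriction maps is not an isomorphism.
   Context: $G=\mathrm{SL}_2$ is regarded as an affine algebraic group scheme over $k$, with $k[G]=k[a,b,c,d]/(ad-bc-1)$. The diagonal subgroup is $T$, and $N=T\cup\sigma T$ with $\sigma=\begin{pmatrix}0&1\\1&0\end{pmatrix}$ (which has determinant $-1=1$ in characteristic two). $k[G/N]$ is the ring of regular functions on $G$ invariant under right translation by $N$, viewed as a rational $G$-module through left translation, i.e. $(g\cdot f)(x)=f(g^{-1}x)$. The $r$-th Frobenius kernel $G_r$ is the (infinitesimal, scheme-theoretic) kernel of the $r$-th iterate of the Frobenius homomorphism $G\to G$ which raises matrix entries to the $2^r$-th power. For an affine group scheme $H$ over $k$ and a rational $H$-module $M$, $H^i(H,M)$ denotes rational cohomology, i.e. the $i$-th right derived functor of $M\mapsto M^H$ on rational $H$-modules (equivalently $\mathrm{Ext}^i_H(k,M)$). The transition maps of the inverse system are the restriction maps $H^1(G_{r+1},-)\to H^1(G_r,-)$. *)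

(* Defs.v *)
From HB Require Import structures.
From mathcomp Require Import all_boot all_order all_algebra.
From mathcomp Require Import ring_quotient mpoly boolp classical_sets.

Set Implicit Arguments.
Unset Strict Implicit.
Unset Printing Implicit Defensive.

Import GRing.Theory.
Local Open Scope quotient_scope.
Local Open Scope ring_scope.


Section Bilinear.
Variables (k : fieldType) (M N V : lmodType k).

Definition bilin (b : M -> N -> V) : Prop :=
  (forall n, linear (b^~ n)) /\ (forall m, linear (b m)).

Definition formal_sum (b : M -> N -> V) (s : seq (M * N)) : V :=
  \sum_(p <- s) b p.1 p.2.

End Bilinear.

Section Tensor.
Variables (k : fieldType) (M N : lmodType k).

(* Two formal sums of pairs are identified when no bilinear map separates
   them. *)
Definition tens_eq (s t : seq (M * N)) : bool :=
  `[< forall (V : lmodType k) (b : M -> N -> V),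
        bilin b -> formal_sum b s = formal_sum b t >].

Lemma tens_eq_equiv : equiv_class_of tens_eq.
Proof.
split=> [s|s t|t s u].
- by apply/asboolP.
- by apply/asboolP/asboolP => h V b hb; rewrite h.
- by move=> /asboolP h1 /asboolP h2; apply/asboolP => V b hb; rewrite h1 // h2.
Qed.

Canonical tens_eq_equivRel := EquivRelPack tens_eq_equiv.

Definition tensor := {eq_quot tens_eq}.
HB.instance Definition _ := Choice.on tensor.
HB.instance Definition _ : EqQuotient _ tens_eq tensor := EqQuotient.on tensor.

Definition tens (m : M) (n : N) : tensor := \pi_tensor [:: (m, n)].

Definition tlift (V : lmodType k) (b : M -> N -> V) (hb : bilin b) (x : tensor) : V :=
  formal_sum b (repr x).

Lemma tlift_pi V b (hb : @bilin k M N V b) s :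
  tlift hb (\pi_tensor s) = formal_sum b s.
Proof.
have /eqmodP /asboolP h : repr (\pi_tensor s) = s %[mod tensor] by rewrite reprK.
exact: h.
Qed.

Lemma tens_ext (x y : tensor) :
  (forall V b (hb : @bilin k M N V b), tlift hb x = tlift hb y) -> x = y.
Proof.
move=> h; rewrite -[x]reprK -[y]reprK; apply/eqmodP/asboolP => V b hb.
exact: (h V b hb).
Qed.

Definition tens0 : tensor := \pi_tensor [::].
Definition tens_add (x y : tensor) : tensor := \pi_tensor (repr x ++ repr y).
Definition tens_scale (c : k) (x : tensor) : tensor :=
  \pi_tensor [seq (c *: p.1, p.2) | p <- repr x].
Definition tens_opp : tensor -> tensor := tens_scale (-1).

Section LiftOps.
Variables (V : lmodType k) (b : M -> N -> V) (hb : bilin b).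

Lemma tlift0 : tlift hb tens0 = 0.
Proof. by rewrite tlift_pi /formal_sum big_nil. Qed.

Lemma tliftD x y : tlift hb (tens_add x y) = tlift hb x + tlift hb y.
Proof. by rewrite tlift_pi /formal_sum big_cat. Qed.

Lemma tliftZ c x : tlift hb (tens_scale c x) = c *: tlift hb x.
Proof.
rewrite tlift_pi /formal_sum big_map scaler_sumr; apply: eq_bigr => -[m n] _ /=.
exact: (GRing.scalable_linear (hb.1 n)).
Qed.

Lemma tliftN x : tlift hb (tens_opp x) = - tlift hb x.
Proof. by rewrite tliftZ scaleN1r. Qed.

End LiftOps.

Let liftE := (tlift0, tliftD, tliftZ, tliftN).

Fact tens_addA : associative tens_add.
Proof. by move=> x y z; apply: tens_ext => V b hb; rewrite !liftE addrA. Qed.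
Fact tens_addC : commutative tens_add.
Proof. by move=> x y; apply: tens_ext => V b hb; rewrite !liftE addrC. Qed.
Fact tens_add0 : left_id tens0 tens_add.
Proof. by move=> x; apply: tens_ext => V b hb; rewrite !liftE add0r. Qed.
Fact tens_addN : left_inverse tens0 tens_opp tens_add.
Proof. by move=> x; apply: tens_ext => V b hb; rewrite !liftE addNr. Qed.
HB.instance Definition _ :=
  GRing.isZmodule.Build tensor tens_addA tens_addC tens_add0 tens_addN.

Fact tens_scaleA a b (x : tensor) :
  tens_scale a (tens_scale b x) = tens_scale (a * b) x.
Proof. by apply: tens_ext => V f hf; rewrite !liftE scalerA. Qed.
Fact tens_scale1 : left_id 1 tens_scale.
Proof. by move=> x; apply: tens_ext => V b hb; rewrite !liftE scale1r. Qed.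
Fact tens_scaleDr : right_distributive tens_scale +%R.
Proof. by move=> c x y; apply: tens_ext => V b hb; rewrite !liftE scalerDr. Qed.
Fact tens_scaleDl (x : tensor) : {morph tens_scale^~ x : a b / a + b}.
Proof. by move=> a c; apply: tens_ext => V b hb; rewrite !liftE scalerDl. Qed.
HB.instance Definition _ := GRing.Zmodule_isLmodule.Build k tensor
  tens_scaleA tens_scale1 tens_scaleDr tens_scaleDl.

Lemma tlift_linear V b (hb : @bilin k M N V b) : linear (tlift hb).
Proof. by move=> c x y; rewrite [LHS]tliftD tliftZ. Qed.
HB.instance Definition _ V b (hb : @bilin k M N V b) :=
  GRing.isLinear.Build k tensor V *:%R (tlift hb) (tlift_linear hb).

Lemma tliftE V b (hb : @bilin k M N V b) m n : tlift hb (tens m n) = b m n.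
Proof. by rewrite tlift_pi /formal_sum big_seq1. Qed.

Lemma tens_bilin : bilin tens.
Proof.
split=> [n c m m'|m c n n']; apply: tens_ext => V b hb.
  by rewrite linearP /= !tliftE; exact: (hb.1 n c m m').
by rewrite linearP /= !tliftE; exact: (hb.2 m c n n').
Qed.

Lemma tensDl m m' n : tens (m + m') n = tens m n + tens m' n.
Proof. by have := tens_bilin.1 n 1 m m'; rewrite /= !scale1r. Qed.
Lemma tensDr m n n' : tens m (n + n') = tens m n + tens m n'.
Proof. by have := tens_bilin.2 m 1 n n'; rewrite !scale1r. Qed.
Lemma tens0l n : tens 0 n = 0.
Proof. by apply: (addrI (tens 0 n)); rewrite -tensDl !addr0. Qed.
Lemma tens0r m : tens m 0 = 0.
Proof. by apply: (addrI (tens m 0)); rewrite -tensDr !addr0. Qed.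
Lemma tensZl c m n : tens (c *: m) n = c *: tens m n.
Proof. by have := tens_bilin.1 n c m 0; rewrite /= tens0l !addr0. Qed.
Lemma tensZr c m n : tens m (c *: n) = c *: tens m n.
Proof. by have := tens_bilin.2 m c n 0; rewrite tens0r !addr0. Qed.
Lemma tens_suml n (I : Type) (r : seq I) (F : I -> M) :
  tens (\sum_(i <- r) F i) n = \sum_(i <- r) tens (F i) n.
Proof. by elim/big_rec2: _ => [|i x y _ <-]; rewrite (tens0l, tensDl). Qed.

Lemma tens_decomp (x : tensor) : x = \sum_(p <- repr x) tens p.1 p.2.
Proof.
apply: tens_ext => V b hb; rewrite linear_sum /=.
by under eq_bigr do rewrite tliftE.
Qed.

Lemma tensor_ind (P : tensor -> Prop) :
  P 0 -> (forall x y, P x -> P y -> P (x + y)) -> (forall m n, P (tens m n)) ->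
  forall x, P x.
Proof. by move=> P0 PD Pt x; rewrite (tens_decomp x); elim/big_ind: _. Qed.

Lemma eq_tensor (V : lmodType k) (f g : {linear tensor -> V}) :
  (forall m n, f (tens m n) = g (tens m n)) -> f =1 g.
Proof.
move=> fg; elim/tensor_ind => [|x y hx hy|//]; first by rewrite !linear0.
by rewrite !linearD hx hy.
Qed.

End Tensor.

Section TensorMap.
Variables (k : fieldType).
Implicit Types M N : lmodType k.

Section Tmap.
Variables (M N M' N' : lmodType k).
Variables (f : {linear M -> M'}) (g : {linear N -> N'}).

Fact tmap_bilin : bilin (fun m n => tens (f m) (g n)).
Proof.
split=> [n|m] c x y /=; rewrite linearP.
  by rewrite tensDl tensZl.
by rewrite tensDr tensZr.
Qed.

Definition tmap : tensor M N -> tensor M' N' := tlift tmap_bilin.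
HB.instance Definition _ := GRing.Linear.on tmap.

Lemma tmapE m n : tmap (tens m n) = tens (f m) (g n).
Proof. exact: tliftE. Qed.

End Tmap.

Section Slice.
Variables (M N : lmodType k) (l : {linear N -> k^o}).

Fact slice_bilin : bilin (fun (m : M) n => (l n : k) *: m).
Proof.
split=> [n|m] c x y /=; first by rewrite scalerDr !scalerA mulrC.
by rewrite linearP scalerDl -scalerA.
Qed.

Definition slice : tensor M N -> M := tlift slice_bilin.
HB.instance Definition _ := GRing.Linear.on slice.

Lemma sliceE m n : slice (tens m n) = (l n : k) *: m.
Proof. exact: tliftE. Qed.

End Slice.

Definition subspace (W : lmodType k) (S : W -> Prop) : Prop :=
  S 0 /\ forall c x y, S x -> S y -> S (c *: x + y).

Section Functional.
Variables (W : lmodType k) (S : W -> Prop) (a : W).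
Hypotheses (subS : subspace S) (Sa : ~ S a).

Let good (U : set W) : Prop :=
  ~ U a /\ forall c x y, U x \/ S x -> U y \/ S y -> U (c *: x + y) \/ S (c *: x + y).

Lemma linear_functional :
  exists l : {linear W -> k^o}, l a = 1 /\ forall w, S w -> l w = 0.
Proof.
have [F FP totF|U [[Ua clU] maxU]] := @Zorn_bigcup W good.
  split=> [[X FX Xa]|c x y]; first by have [] := FP X FX.
  move=> [[X FX Xx]|Sx] [[Y FY Yy]|Sy]; last by right; apply: subS.2.
  - have [XY|YX] := totF X Y FX FY.
    + have [_ cl] := FP Y FY.
      have [||h|h] := cl c x y; [by left; exact: XY|by left| |by right].
      by left; exists Y.
    + have [_ cl] := FP X FX.
      have [||h|h] := cl c x y; [by left|by left; exact: YX| |by right].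
      by left; exists X.
  - have [_ cl] := FP X FX.
    have [||h|h] := cl c x y; [by left|by right| |by right].
    by left; exists X.
  - have [_ cl] := FP Y FY.
    have [||h|h] := cl c x y; [by right|by left| |by right].
    by left; exists Y.
pose D w := U w \/ S w.
have D0 : D 0 by right; exact: subS.1.
have DZ c x : D x -> D (c *: x) by move=> Dx; rewrite -[_ *: _]addr0; apply: clU.
have DD x y : D x -> D y -> D (x + y).
  by move=> Dx Dy; rewrite -[x]scale1r; apply: clU.
have DN x : D x -> D (- x) by rewrite -scaleN1r; exact: DZ.
have Da : ~ D a by case.
have ex w : exists c, D (w - c *: a).
  apply: contrapT => nex.
  pose B : set W := fun v => exists c d, D d /\ v = c *: w + d.
  have DB v : D v -> B v by move=> Dv; exists 0, v; rewrite scale0r add0r.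
  have Bw : B w by exists 1, 0; rewrite scale1r addr0.
  have Uw : ~ U w.
    by move=> Uw; apply: nex; exists 0; rewrite scale0r subr0; left.
  apply: (maxU B); first split.
  - by move=> v Uv; apply: DB; left.
  - by move=> BU; apply: Uw; apply: BU.
  split=> [[c [d [Dd ae]]]|c x y Bx By].
    apply: nex; exists c^-1.
    have c0 : c != 0.
      by apply/eqP => c0; apply: Da; rewrite ae c0 scale0r add0r.
    rewrite ae scalerDr scalerA mulVf // scale1r opprD addrA subrr add0r.
    by apply: DN; apply: DZ.
  have {Bx}[c1 [d1 [D1 ->]]] : B x by case: Bx => // Sx; apply: DB; right.
  have {By}[c2 [d2 [D2 ->]]] : B y by case: By => // Sy; apply: DB; right.
  left; exists (c * c1 + c2), (c *: d1 + d2); split; first exact: clU.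
  by rewrite scalerDr scalerA scalerDl addrACA.
pose f w : k^o := projT1 (cid (ex w)).
have fP w : D (w - f w *: a) by rewrite /f; case: cid.
have uniq w c : D (w - c *: a) -> f w = c.
  move=> h; apply/eqP; rewrite -subr_eq0; apply/negPn/negP => n0; apply: Da.
  have := DZ (f w - c)^-1 _ (DD _ _ h (DN _ (fP w))).
  have -> : w - c *: a - (w - f w *: a) = (f w - c) *: a.
    by rewrite opprB addrC addrA subrK scalerBl.
  by rewrite scalerA mulVf // scale1r.
have flin : linear f.
  move=> c x y; apply: uniq.
  have -> : c *: x + y - (c *: f x + f y) *: a
          = c *: (x - f x *: a) + (y - f y *: a).
    by rewrite scalerDl opprD addrACA scalerBr scalerA.
  by apply: DD => //; apply: DZ.
pose L := GRing.isLinear.Build k W k^o *:%R f flin.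
exists (HB.pack f L : {linear W -> k^o}); split=> [|w Sw] /=; apply: uniq.
  by rewrite scale1r subrr.
by rewrite scale0r subr0; right.
Qed.

End Functional.

(* An element of M ⊗ N all of whose slices lie in S is a sum of pure tensors
   with left factors in S. *)
Lemma tensor_slice (M N : lmodType k) (S : M -> Prop) (t : tensor M N) :
  subspace S -> (forall l : {linear N -> k^o}, S (slice l t)) ->
  exists2 s : seq (M * N), t = \sum_(p <- s) tens p.1 p.2 &
    forall p, p \in s -> S p.1.
Proof.
move=> subS; rewrite (tens_decomp t); move: (repr t) => s.
have SZ c x : S x -> S (c *: x).
  by move=> Sx; rewrite -[_ *: _]addr0; apply: subS.2 => //; exact: subS.1.
have SD x y : S x -> S y -> S (x + y).
  by move=> Sx Sy; rewrite -[x]scale1r; apply: subS.2.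
have [n] := ubnP (size s); elim: n s => // n IH [|[m a] s] /= ltn hs.
  by exists [::]; rewrite ?big_nil.
pose span (w : N) := exists c : seq k, size c = size s /\
   w = \sum_(p <- zip c s) p.1 *: p.2.2.
have zip0 (r : seq (M * N)) : 0 = \sum_(p <- zip (nseq (size r) (0 : k)) r) p.1 *: p.2.2.
  by elim: r => [|p r IHr] /=; rewrite ?big_nil // big_cons /= scale0r add0r.
have span0 : span 0 by exists (nseq (size s) 0); rewrite size_nseq -zip0.
have sspan : subspace span.
  split=> // c _ _ [u [su ->]] [v [sv ->]].
  exists [seq c * p.1 + p.2 | p <- zip u v].
  split; first by rewrite size_map size_zip su sv minnn.
  elim: s u v su sv {hs span span0 ltn} => [|p s IHs] [|x u] [|y v] //=.
    by rewrite !big_nil scaler0 addr0.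
  move=> [su] [sv]; rewrite !big_cons /= -IHs // scalerDr addrACA.
  by rewrite scalerA scalerDl.
have [[c [sc ae]]|na] := pselect (span a).
  pose s' := [seq (p.2.1 + p.1 *: m, p.2.2) | p <- zip c s].
  have E : \sum_(p <- (m, a) :: s) tens p.1 p.2 = \sum_(p <- s') tens p.1 p.2.
    rewrite big_cons /= ae {}/s' big_map.
    elim: s c sc {hs ltn span span0 sspan ae} => [|p s IHs] [|x c] //=.
      by rewrite !big_nil tens0r addr0.
    move=> [sc]; rewrite !big_cons /= -IHs // tensDr tensDl tensZr tensZl.
    by rewrite addrACA [_ + tens p.1 _]addrC.
  rewrite E; rewrite E in hs; apply: IH => //.
  by rewrite size_map size_zip sc minnn.
have [l [la ls]] := linear_functional sspan na.
have lz p : p \in s -> l p.2 = 0.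
  move=> ps; apply: ls.
  elim: s ps {hs ltn span0 sspan na} @span => // q s IHs; rewrite inE.
  case/orP=> [/eqP ->|ps].
    exists (1 :: nseq (size s) 0); rewrite /= size_nseq; split=> //.
    by rewrite big_cons /= scale1r -zip0 addr0.
  have [c [sc ->]] := IHs ps.
  by exists (0 :: c); rewrite /= sc big_cons scale0r add0r.
have Sm : S m.
  have := hs l; rewrite big_cons linearD /= sliceE la scale1r linear_sum /=.
  by rewrite big_seq big1 ?addr0 // => p ps; rewrite sliceE lz ?scale0r.
have [//|l'|s' E Ss'] := IH s.
  have := hs l'; rewrite big_cons linearD /= sliceE => h.
  have := SD _ _ (SZ (- l' a) _ Sm) h.
  by rewrite scaleNr addrA addNr add0r.
exists ((m, a) :: s'); first by rewrite !big_cons E.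
by move=> p; rewrite inE => /orP[/eqP ->|/Ss'].
Qed.

Lemma tmap_id (M N : lmodType k) (t : tensor M N) : tmap idfun idfun t = t.
Proof. by apply: (eq_tensor (f := tmap idfun idfun) (g := idfun)) => m n /=; rewrite tmapE. Qed.

Lemma tmap_inj (M M' N : lmodType k) (f : {linear M -> M'}) :
  injective f -> injective (tmap f (idfun : {linear N -> N})).
Proof.
move=> finj x y xy; apply/eqP; rewrite -subr_eq0; apply/eqP.
have {xy} : tmap f (idfun : {linear N -> N}) (x - y) = 0 by rewrite linearB /= xy subrr.
move: (x - y) => t t0.
have [||s -> s0] := @tensor_slice M N (fun m => m = 0) t.
- by split=> // c u v -> ->; rewrite scaler0 addr0.
- move=> l; apply: finj; rewrite linear0.
  transitivity (slice l (tmap f (idfun : {linear N -> N}) t)); last by rewrite t0 linear0.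
  apply: (eq_tensor (f := f \o slice l) (g := slice l \o tmap f idfun)) => m n /=.
  by rewrite tmapE !sliceE linearZ.
by rewrite big_seq big1 // => p /s0 ->; rewrite tens0l.
Qed.

End TensorMap.

Section TensorAlgebra.
Variables (k : fieldType) (A B : comAlgType k).
Local Notation T := (tensor A B).

Fact tens_mul1_bilin (a : A) (b : B) : bilin (fun x y => tens (a * x) (b * y)).
Proof.
split=> [y|x] c u v /=; rewrite mulrDr -scalerAr.
  by rewrite tensDl tensZl.
by rewrite tensDr tensZr.
Qed.

Fact tens_mul_bilin (y : T) : bilin (fun a b => tlift (tens_mul1_bilin a b) y).
Proof.
split=> [n|m] c u v /=; elim/tensor_ind: y => [|x y hx hy|a b]; rewrite ?linear0 ?scaler0 ?addr0 //.
- by rewrite !linearD /= hx hy addrACA.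
- by rewrite !tliftE mulrDl -scalerAl tensDl tensZl.
- by rewrite !linearD /= hx hy addrACA.
- by rewrite !tliftE mulrDl -scalerAl tensDr tensZr.
Qed.

Definition tens_one : T := tens 1 1.
Definition tens_mul (x y : T) : T := tlift (tens_mul_bilin y) x.

Lemma tens_mulE a b a' b' :
  tens_mul (tens a b) (tens a' b') = tens (a * a') (b * b').
Proof. by rewrite /tens_mul !tliftE. Qed.

Fact tens_mulDl : left_distributive tens_mul +%R.
Proof. by move=> x y z; rewrite /tens_mul linearD. Qed.
Fact tens_mulC : commutative tens_mul.
Proof.
have z y : tens_mul y 0 = 0.
  elim/tensor_ind: y => [|x y hx hy|a b]; first by rewrite /tens_mul linear0.
    by rewrite tens_mulDl hx hy addr0.
  by rewrite /tens_mul tliftE linear0.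
move=> x y; elim/tensor_ind: x => [|x x' hx hx'|a b].
- by rewrite z /tens_mul linear0.
- rewrite tens_mulDl hx hx' {hx hx'}.
  elim/tensor_ind: y => [|y y' hy hy'|a b]; first by rewrite /tens_mul !linear0 addr0.
    by rewrite !tens_mulDl -hy -hy' addrACA.
  by rewrite /tens_mul !tliftE linearD.
- elim/tensor_ind: y => [|y y' hy hy'|a' b'].
  + by rewrite z /tens_mul linear0.
  + by rewrite tens_mulDl -hy -hy' /tens_mul !tliftE linearD.
  + by rewrite !tens_mulE mulrC [b * _]mulrC.
Qed.
Fact tens_mulDr : right_distributive tens_mul +%R.
Proof. by move=> x y z; rewrite tens_mulC tens_mulDl !(tens_mulC x). Qed.
Fact tens_mul0 x : tens_mul 0 x = 0.
Proof. by rewrite /tens_mul linear0. Qed.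
Fact tens_mulA : associative tens_mul.
Proof.
move=> x y z.
elim/tensor_ind: x => [|x x' hx hx'|a b]; first by rewrite !tens_mul0.
  by rewrite !tens_mulDl hx hx'.
elim/tensor_ind: y => [|y y' hy hy'|a' b'].
- by rewrite tens_mul0 ![tens_mul (tens a b) _]tens_mulC !tens_mul0.
- by rewrite tens_mulDl !tens_mulDr tens_mulDl hy hy'.
elim/tensor_ind: z => [|z z' hz hz'|a'' b''].
- by rewrite !(tens_mulC _ 0) !tens_mul0 tens_mulC tens_mul0.
- by rewrite !tens_mulDr hz hz'.
by rewrite !tens_mulE !mulrA.
Qed.
Fact tens_mul1 : left_id tens_one tens_mul.
Proof.
elim/tensor_ind=> [|x y hx hy|a b].
- by rewrite tens_mulC tens_mul0.
- by rewrite tens_mulDr hx hy.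
by rewrite tens_mulE !mul1r.
Qed.
Fact tens_one_neq0 : tens_one != 0.
Proof.
have s0 : subspace (fun b : B => b = 0).
  by split=> // c u v -> ->; rewrite scaler0 addr0.
have [l [l1 _]] := linear_functional s0 (elimN eqP (oner_neq0 B)).
apply/eqP => /(congr1 (slice l)) /eqP.
by rewrite sliceE l1 linear0 scale1r oner_eq0.
Qed.
HB.instance Definition _ := GRing.Zmodule_isComNzRing.Build T
  tens_mulA tens_mulC tens_mul1 tens_mulDl tens_one_neq0.

Lemma tensM a b a' b' : (tens a b : T) * tens a' b' = tens (a * a') (b * b').
Proof. exact: tens_mulE. Qed.

Fact tens_scaleAl c (x y : T) : c *: (x * y) = (c *: x) * y.
Proof. by rewrite [X in _ = X]/GRing.mul /= /tens_mul linearZ. Qed.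
HB.instance Definition _ := GRing.Lmodule_isLalgebra.Build k T tens_scaleAl.
Fact tens_scaleAr c (x y : T) : c *: (x * y) = x * (c *: y).
Proof. by rewrite mulrC tens_scaleAl mulrC. Qed.
HB.instance Definition _ := GRing.Lalgebra_isAlgebra.Build k T tens_scaleAr.

End TensorAlgebra.

Section TensorInclusions.
Variables (k : fieldType) (A B : comAlgType k).

Definition tensl (a : A) : tensor A B := tens a 1.
Definition tensr (b : B) : tensor A B := tens 1 b.

Fact tensl_linear : linear tensl.
Proof. by move=> c x y; rewrite /tensl tensDl tensZl. Qed.
Fact tensr_linear : linear tensr.
Proof. by move=> c x y; rewrite /tensr tensDr tensZr. Qed.
Fact tensl_monoid : monoid_morphism tensl.
Proof. by split=> // x y; rewrite /tensl tensM mulr1. Qed.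
Fact tensr_monoid : monoid_morphism tensr.
Proof. by split=> // x y; rewrite /tensr tensM mulr1. Qed.
HB.instance Definition _ := GRing.isLinear.Build k A (tensor A B) *:%R tensl tensl_linear.
HB.instance Definition _ := GRing.isLinear.Build k B (tensor A B) *:%R tensr tensr_linear.
HB.instance Definition _ := GRing.isMonoidMorphism.Build A (tensor A B) tensl tensl_monoid.
HB.instance Definition _ := GRing.isMonoidMorphism.Build B (tensor A B) tensr tensr_monoid.

Lemma tenslr a b : tensl a * tensr b = tens a b.
Proof. by rewrite tensM mulr1 mul1r. Qed.

End TensorInclusions.
Arguments tensl {k A} B a.
Arguments tensr {k} A {B} b.

Section TensorProductMorphism.
Variables (k : fieldType) (A B C : comAlgType k).
Variables (f : {lrmorphism A -> C}) (g : {lrmorphism B -> C}).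

Fact tprod_bilin : bilin (fun a b => f a * g b).
Proof.
split=> [b|a] c x y /=; rewrite linearP.
  by rewrite mulrDl scalerAl.
by rewrite mulrDr scalerAr.
Qed.

Definition tprod : tensor A B -> C := tlift tprod_bilin.
HB.instance Definition _ := GRing.Linear.on tprod.

Lemma tprodE a b : tprod (tens a b) = f a * g b.
Proof. exact: tliftE. Qed.

Fact tprod_monoid : monoid_morphism tprod.
Proof.
split=> [|x y]; first by rewrite [LHS]tprodE !rmorph1 mulr1.
elim/tensor_ind: x => [|x x' hx hx'|a b].
- by rewrite mul0r !linear0 mul0r.
- by rewrite mulrDl [LHS]linearD [tprod (x + x')]linearD mulrDl /= hx hx'.
elim/tensor_ind: y => [|y y' hy hy'|a' b'].
- by rewrite mulr0 !linear0 mulr0.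
- by rewrite mulrDr [LHS]linearD [tprod (y + y')]linearD mulrDr /= hy hy'.
by rewrite tensM !tprodE !rmorphM mulrACA.
Qed.
HB.instance Definition _ := GRing.isMonoidMorphism.Build (tensor A B) C tprod tprod_monoid.

Lemma tprodl a : tprod (tensl B a) = f a.
Proof. by rewrite tprodE rmorph1 mulr1. Qed.
Lemma tprodr b : tprod (tensr A b) = g b.
Proof. by rewrite tprodE rmorph1 mul1r. Qed.

End TensorProductMorphism.

(* The group schemes are given by their functors of points, as subgroup functors
   A |-> H(A) of A |-> SL_2(A) on (nonzero) commutative k-algebras.  The inverse
   of a matrix g of determinant 1 is written \adj g. *)
Record sl2_subgroup (k : fieldType) := Sl2Subgroup {
  pts :> forall A : comAlgType k, 'M[A]_2 -> Prop;
  pts_det : forall (A : comAlgType k) (g : 'M[A]_2), pts g -> \det g = 1;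
  pts1 : forall A : comAlgType k, pts (1%:M : 'M[A]_2);
  ptsM : forall (A : comAlgType k) (g h : 'M[A]_2), pts g -> pts h -> pts (g *m h);
  ptsV : forall (A : comAlgType k) (g : 'M[A]_2), pts g -> pts (\adj g);
  pts_map : forall (A B : comAlgType k) (f : {lrmorphism A -> B}) (g : 'M[A]_2),
    pts g -> pts (map_mx f g)
}.

Definition sub_le (k : fieldType) (H' H : sl2_subgroup k) : Prop :=
  forall (A : comAlgType k) (g : 'M[A]_2), H' A g -> H A g.

Section Subgroups.
Variable k : fieldType.
Implicit Types A B : comAlgType k.

Lemma adj1 A : \adj (1%:M : 'M[A]_2) = 1%:M.
Proof. by rewrite -[LHS]mul1mx mul_mx_adj det1. Qed.

Lemma det_adj A (g : 'M[A]_2) : \det g = 1 -> \det (\adj g) = 1.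
Proof.
by move=> dg; have := congr1 determinant (mul_mx_adj g);
  rewrite det_mulmx dg mul1r det1.
Qed.

Lemma mulmxKadj A n (g : 'M[A]_2) (x : 'M[A]_(2, n)) :
  \det g = 1 -> \adj g *m (g *m x) = x.
Proof. by move=> dg; rewrite mulmxA mul_adj_mx dg mul1mx. Qed.

Lemma mulmxVKadj A n (g : 'M[A]_2) (x : 'M[A]_(2, n)) :
  \det g = 1 -> g *m (\adj g *m x) = x.
Proof. by move=> dg; rewrite mulmxA mul_mx_adj dg mul1mx. Qed.

Lemma adjM A (g h : 'M[A]_2) : \det g = 1 -> \det h = 1 ->
  \adj (g *m h) = \adj h *m \adj g.
Proof.
move=> dg dh; have d : \det (g *m h) = 1 by rewrite det_mulmx dg dh mulr1.
have := mulmxKadj (\adj h *m \adj g) d.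
by rewrite -mulmxA mulmxVKadj // mul_mx_adj dg mulmx1.
Qed.

Lemma adjK A (g : 'M[A]_2) : \det g = 1 -> \adj (\adj g) = g.
Proof.
move=> dg; have := mulmxKadj g (det_adj dg).
by rewrite mul_adj_mx dg mulmx1.
Qed.

Definition SL2 : sl2_subgroup k.
Proof.
refine (@Sl2Subgroup k (fun A g => \det g = 1) _ _ _ _ _) => //.
- by move=> A; rewrite det1.
- by move=> A g h dg dh; rewrite det_mulmx dg dh mulr1.
- by move=> A g; exact: det_adj.
- by move=> A B f g dg; rewrite det_map_mx dg rmorph1.
Defined.

Definition torus : sl2_subgroup k.
Proof.
refine (@Sl2Subgroup k (fun A g => \det g = 1 /\ is_diag_mx g) _ _ _ _ _).
- by move=> A g [].
- by move=> A; rewrite det1 scalar_mx_is_diag.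
- move=> A g h [dg gd] [dh hd]; rewrite det_mulmx dg dh mulr1; split=> //.
  have /diag_mxP[u ->] := gd; have /diag_mxP[v ->] := hd.
  by rewrite mulmx_diag diag_mx_is_diag.
- move=> A g [dg gd]; split; first exact: det_adj.
  apply/is_diag_mxP => i j ij; rewrite mxE /cofactor det_mx11 !mxE.
  have /is_diag_mxP h := gd.
  rewrite (h _ _) ?mulr0 //.
  by move: i j ij => [[|[|//]] ?] [[|[|//]] ?].
- move=> A B f g [dg gd]; rewrite det_map_mx dg rmorph1; split=> //.
  have /diag_mxP[u ->] := gd.
  by rewrite map_diag_mx diag_mx_is_diag.
Defined.

(* g normalizes H if g H(B) g^-1 = H(B) for every algebra B over the ring of
   definition of g. *)
Definition normalizes (H : sl2_subgroup k) A (g : 'M[A]_2) : Prop :=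
  forall B (f : {lrmorphism A -> B}) (t : 'M[B]_2),
    \det t = 1 -> (H B t <-> H B (map_mx f g *m t *m \adj (map_mx f g))).

Definition normalizer (H : sl2_subgroup k) : sl2_subgroup k.
Proof.
refine (@Sl2Subgroup k (fun A g => \det g = 1 /\ normalizes H g) _ _ _ _ _).
- by move=> A g [].
- move=> A; split=> [|B f t _]; first exact: det1.
  by rewrite map_mx1 adj1 mul1mx mulmx1.
- move=> A g h [dg ng] [dh nh]; split=> [|B f t dt].
    by rewrite det_mulmx dg dh mulr1.
  have dg' : \det (map_mx f g) = 1 by rewrite det_map_mx dg rmorph1.
  have dh' : \det (map_mx f h) = 1 by rewrite det_map_mx dh rmorph1.
  rewrite map_mxM adjM // (nh _ f) // (ng _ f) ?mulmxA //.
  by rewrite !det_mulmx det_adj // dh' dt !mulr1.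
- move=> A g [dg ng]; split=> [|B f t dt]; first exact: det_adj.
  have dg' : \det (map_mx f g) = 1 by rewrite det_map_mx dg rmorph1.
  rewrite map_mx_adj [X in _ <-> X](ng _ f).
    by rewrite adjK // !mulmxA mul_mx_adj dg' mul1mx -mulmxA mul_mx_adj dg' mulmx1.
  by rewrite !det_mulmx det_adj ?det_adj // dt !mulr1.
- move=> A B f g [dg ng]; split=> [|C h t dt].
    by rewrite det_map_mx dg rmorph1.
  rewrite -map_mx_comp; exact: (ng C (h \o f)).
Defined.

End Subgroups.
Arguments SL2 k.
Arguments torus k.

Section Frobenius.
Variables (k : fieldType) (p : nat).
Hypothesis pcharP : p \in [pchar k].

Definition frob (A : comAlgType k) (r : nat) (x : A) : A := x ^+ (p ^ r).

Fact frob_zmod (A : comAlgType k) r : zmod_morphism (@frob A r).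
Proof.
have pA : p \in [pchar A] by rewrite pchar_lalg.
have h : [pchar A].-nat (p ^ r)%N.
  by rewrite (eq_pnat _ (pcharf_eq pA)) pnatX pnat_id ?(pcharf_prime pcharP).
by move=> x y; rewrite /frob exprDn_pchar ?exprNn_pchar.
Qed.

Fact frob_monoid (A : comAlgType k) r : monoid_morphism (@frob A r).
Proof. by split=> [|x y]; rewrite /frob ?expr1n ?exprMn. Qed.

Definition frob_rmorphism (A : comAlgType k) (r : nat) : {rmorphism A -> A} :=
  HB.pack (@frob A r) (GRing.isZmodMorphism.Build A A _ (@frob_zmod A r))
    (GRing.isMonoidMorphism.Build A A _ (@frob_monoid A r)).

(* The kernel of the r-th iterate of the Frobenius, in characteristic p. *)
Definition frobker (r : nat) : sl2_subgroup k.
Proof.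
refine (@Sl2Subgroup k
  (fun A g => \det g = 1 /\ map_mx (fun x => x ^+ (p ^ r)) g = 1%:M) _ _ _ _ _).
- by move=> A g [].
- by move=> A; rewrite det1 (map_mx1 (frob_rmorphism A r)).
- move=> A g h [dg gF] [dh hF]; rewrite det_mulmx dg dh mulr1.
  by rewrite (map_mxM (frob_rmorphism A r)) /= gF hF mulmx1.
- move=> A g [dg gF]; split; first exact: det_adj.
  by rewrite (map_mx_adj (frob_rmorphism A r)) /= gF adj1.
- move=> A B f g [dg gF]; rewrite det_map_mx dg rmorph1; split=> //.
  rewrite -(map_mx1 f) -gF -!map_mx_comp; apply: eq_map_mx => x /=.
  by rewrite rmorphXn.
Defined.

Lemma frobker_le_SL2 r : sub_le (frobker r) (SL2 k).
Proof. by move=> A g []. Qed.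

Lemma frobker_leS r : sub_le (frobker r) (frobker r.+1).
Proof.
move=> A g [dg gF]; split=> //; rewrite -[RHS](map_mx1 (frob_rmorphism A 1)) -gF.
by rewrite -map_mx_comp; apply: eq_map_mx => x /=; rewrite /frob -exprM -expnD addn1.
Qed.

End Frobenius.

Section RationalModules.
Variable k : fieldType.

(* A point g acts on M as the k-linear map m |-> g (m ⊗ 1); its values at
   matrices outside the group under consideration carry no information. *)
Record module_data := ModuleData {
  mcar :> lmodType k;
  mact : forall A : comAlgType k, 'M[A]_2 -> mcar -> tensor mcar A
}.

Fact amul_bilin (M : lmodType k) (A : comAlgType k) (a : A) :
  bilin (fun (m : M) b => tens m (a * b)).
Proof.
split=> [b|m] c x y /=; first by rewrite tensDl tensZl.
by rewrite mulrDr -scalerAr tensDr tensZr.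
Qed.

Definition amul (M : lmodType k) (A : comAlgType k) (a : A) :
  tensor M A -> tensor M A := tlift (amul_bilin M a).
HB.instance Definition _ M A a := GRing.Linear.on (@amul M A a).

Lemma amulE (M : lmodType k) (A : comAlgType k) (a : A) (m : M) b :
  amul a (tens m b) = tens m (a * b).
Proof. exact: tliftE. Qed.

(* The A-linear extension M ⊗ A -> M' ⊗ A of F. *)
Definition aext (M M' : lmodType k) (A : comAlgType k) (F : M -> tensor M' A)
    (x : tensor M A) : tensor M' A :=
  \sum_(p <- repr x) amul p.2 (F p.1).

(* M is an H-module: each H(A) acts A-linearly on M ⊗ A, functorially in A.  For
   an affine group scheme H this is the same as a k[H]-comodule. *)
Record is_rational (H : sl2_subgroup k) (M : module_data) : Prop := IsRational {
  act_linear : forall (A : comAlgType k) (g : 'M[A]_2), H A g -> linear (@mact M A g);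
  act1 : forall (A : comAlgType k) (m : M), mact (1%:M : 'M[A]_2) m = tens m 1;
  actM : forall (A : comAlgType k) (g h : 'M[A]_2), H A g -> H A h ->
    forall m : M, mact (g *m h) m = aext (mact g) (mact h m);
  act_map : forall (A B : comAlgType k) (f : {lrmorphism A -> B}) (g : 'M[A]_2), H A g ->
    forall m : M, mact (map_mx f g) m = tmap idfun f (mact g m)
}.

Record rmodule (H : sl2_subgroup k) := RModule {
  rdata :> module_data;
  rmoduleP : is_rational H rdata
}.

Lemma is_rational_sub (H' H : sl2_subgroup k) M :
  sub_le H' H -> is_rational H M -> is_rational H' M.
Proof.
move=> le [h1 h2 h3 h4]; split=> //.
- by move=> A g /le; exact: h1.
- by move=> A g h /le Hg /le Hh; exact: h3.
- by move=> A B f g /le; exact: h4.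
Qed.

Definition restrict (H' H : sl2_subgroup k) (le : sub_le H' H) (M : rmodule H) :
  rmodule H' := RModule (is_rational_sub le (rmoduleP M)).

Definition invariant (H : sl2_subgroup k) (M : module_data) (m : M) : Prop :=
  forall (A : comAlgType k) (g : 'M[A]_2), H A g -> mact g m = tens m 1.

Record rhom (H : sl2_subgroup k) (M N : module_data) := RHom {
  rhom_fun :> {linear M -> N};
  rhomP : forall (A : comAlgType k) (g : 'M[A]_2), H A g ->
    forall m : M, tmap rhom_fun idfun (mact g m) = mact g (rhom_fun m)
}.

Section Aext.
Variables (M M' : lmodType k) (A : comAlgType k) (F : M -> tensor M' A).
Hypothesis Flin : linear F.

Fact aext_bilin : bilin (fun m a => amul a (F m)).
Proof.
split=> [a|m] c x y /=; first by rewrite Flin linearP.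
elim/tensor_ind: (F m) => [|u v hu hv|n b].
- by rewrite !linear0 addr0.
- by rewrite !linearD /= hu hv addrACA.
- by rewrite !amulE mulrDl -scalerAl tensDr tensZr.
Qed.

Lemma aext_tlift x : aext F x = tlift aext_bilin x.
Proof. by []. Qed.

Lemma aextE m a : aext F (tens m a) = amul a (F m).
Proof. by rewrite aext_tlift tliftE. Qed.

Lemma aext0 : aext F 0 = 0.
Proof. by rewrite aext_tlift linear0. Qed.

Lemma aextD x y : aext F (x + y) = aext F x + aext F y.
Proof. by rewrite !aext_tlift linearD. Qed.

End Aext.

(* A subspace i : V -> M stable under H, as a rational module. *)
Section Submodule.
Variables (H : sl2_subgroup k) (M : rmodule H) (V : lmodType k).
Variables (i : {linear V -> M}).

Definition sub_act (A : comAlgType k) (g : 'M[A]_2) (v : V) : tensor V A :=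
  xget 0 [set t | tmap i idfun t = mact g (i v)]%classic.

Definition sub_data := @ModuleData V sub_act.

Hypothesis i_inj : injective i.
Hypothesis i_stable : forall (A : comAlgType k) (g : 'M[A]_2), H A g ->
  forall v, exists t, tmap i idfun t = mact g (i v).

Lemma sub_actE (A : comAlgType k) (g : 'M[A]_2) (v : V) :
  H A g -> tmap i idfun (sub_act g v) = mact g (i v).
Proof.
rewrite /sub_act => Hg; case: xgetP => [t _ //|no].
by have [t /no] := i_stable Hg v.
Qed.

Lemma sub_rational : is_rational H sub_data.
Proof.
have [Mlin M1 MM Mmap] := rmoduleP M.
have inj (A : comAlgType k) : injective (tmap i (idfun : {linear A -> A})) := @tmap_inj _ _ _ A i i_inj.
have slin (A : comAlgType k) (g : 'M[A]_2) : H A g -> linear (@sub_act A g).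
  move=> Hg c u v; apply: inj; rewrite linearP /= !sub_actE // linearP.
  exact: Mlin.
split=> //=.
- move=> A v; apply: inj; rewrite sub_actE; last exact: pts1.
  by rewrite M1 tmapE.
- move=> A g h Hg Hh v; apply: inj; rewrite sub_actE; last exact: ptsM.
  rewrite MM // -sub_actE //; elim/tensor_ind: (sub_act h v) => [|x y hx hy|m a].
  + by rewrite linear0 !aext0 ?linear0 //; [exact: Mlin|exact: slin].
  + by rewrite linearD !aextD ?linearD ?hx ?hy //; [exact: Mlin|exact: slin].
  rewrite tmapE !aextE -?sub_actE //; [|exact: slin|exact: Mlin].
  elim/tensor_ind: (sub_act g m) => [|x y hx hy|m' a']; first by rewrite !linear0.
    by rewrite !linearD /= hx hy.
  by rewrite !(tmapE, amulE).
- move=> A B f g Hg v; apply: inj; rewrite sub_actE; last exact: pts_map.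
  rewrite Mmap // -sub_actE //; elim/tensor_ind: (sub_act g v) => [|x y hx hy|m a].
  + by rewrite !linear0.
  + by rewrite !linearD /= hx hy.
  + by rewrite !tmapE.
Qed.

Definition submodule : rmodule H := RModule sub_rational.

End Submodule.

End RationalModules.

Section CoordinateRing.
Variable k : fieldType.

(* k[a, b, c, d], the variables being indexed by the entries of a 2 x 2
   matrix. *)
Definition gen_mx : 'M[{mpoly k[2 * 2]}]_2 := \matrix_(i, j) 'X_(mxvec_index i j).

Definition mx_eval (A : comAlgType k) (x : 'M[A]_2) : {mpoly k[2 * 2]} -> A :=
  mmap (in_alg A) (mxvec x 0).
HB.instance Definition _ A x := GRing.RMorphism.on (@mx_eval A x).

Lemma mx_evalC (A : comAlgType k) (x : 'M[A]_2) c : mx_eval x c%:MP = c%:A.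
Proof. by rewrite /mx_eval mmapC. Qed.

Lemma mx_eval_gen (A : comAlgType k) (x : 'M[A]_2) : map_mx (mx_eval x) gen_mx = x.
Proof. by apply/matrixP => i j; rewrite !mxE /mx_eval mmapX mmap1U mxvecE. Qed.

Lemma mx_eval_map (A B : comAlgType k) (f : {lrmorphism A -> B}) (x : 'M[A]_2) q :
  f (mx_eval x q) = mx_eval (map_mx f x) q.
Proof.
rewrite /mx_eval /mmap raddf_sum; apply: eq_bigr => m _ /=.
rewrite rmorphM /= rmorph_alg; congr (_ * _).
rewrite /mmap1 rmorph_prod; apply: eq_bigr => i _.
rewrite rmorphXn; congr (_ ^+ _).
by case/mxvec_indexP: i => i j; rewrite !mxvecE mxE.
Qed.

Definition det_ideal : {pred {mpoly k[2 * 2]}} :=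
  fun q => `[< exists q', q = q' * (\det gen_mx - 1) >].

Fact det_ideal_eval (A : comAlgType k) (x : 'M[A]_2) q :
  \det x = 1 -> q \in det_ideal -> mx_eval x q = 0.
Proof.
move=> dx /asboolP[q' ->].
by rewrite rmorphM rmorphB rmorph1 -det_map_mx mx_eval_gen dx subrr mulr0.
Qed.

Fact det_ideal_closed : idealr_closed det_ideal.
Proof.
split.
- by apply/asboolP; exists 0; rewrite mul0r.
- apply/negP => /(det_ideal_eval (det1 k^o 2)) /eqP.
  by rewrite rmorph1 oner_eq0.
- move=> a u v /asboolP[u' ->] /asboolP[v' ->]; apply/asboolP.
  by exists (a * u' + v'); rewrite mulrDl mulrA.
Qed.
HB.instance Definition _ := isIdealr.Build _ det_ideal det_ideal_closed.

(* k[a, b, c, d]/(ad - bc - 1) *)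
Definition kSL2 := {ideal_quot det_ideal}.
HB.instance Definition _ := GRing.ComNzRing.on kSL2.

Definition kSL2_pi : {mpoly k[2 * 2]} -> kSL2 := \pi_{ideal_quot det_ideal}.
HB.instance Definition _ := GRing.RMorphism.on kSL2_pi.

Definition kSL2_scale (c : k) (f : kSL2) : kSL2 := kSL2_pi c%:MP * f.

Fact kSL2_scaleA a b f : kSL2_scale a (kSL2_scale b f) = kSL2_scale (a * b) f.
Proof. by rewrite /kSL2_scale mulrA -rmorphM -mpolyCM. Qed.
Fact kSL2_scale1 : left_id 1 kSL2_scale.
Proof. by move=> f; rewrite /kSL2_scale mpolyC1 rmorph1 mul1r. Qed.
Fact kSL2_scaleDr : right_distributive kSL2_scale +%R.
Proof. by move=> c f g; rewrite /kSL2_scale mulrDr. Qed.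
Fact kSL2_scaleDl f : {morph kSL2_scale^~ f : a b / a + b}.
Proof. by move=> a b; rewrite /kSL2_scale mpolyCD rmorphD mulrDl. Qed.
HB.instance Definition _ := GRing.Zmodule_isLmodule.Build k kSL2
  kSL2_scaleA kSL2_scale1 kSL2_scaleDr kSL2_scaleDl.
Fact kSL2_scaleAl c (f g : kSL2) : c *: (f * g) = (c *: f) * g.
Proof. exact: mulrA. Qed.
HB.instance Definition _ := GRing.Lmodule_isLalgebra.Build k kSL2 kSL2_scaleAl.
Fact kSL2_scaleAr c (f g : kSL2) : c *: (f * g) = f * (c *: g).
Proof. by rewrite mulrC kSL2_scaleAl mulrC. Qed.
HB.instance Definition _ := GRing.Lalgebra_isAlgebra.Build k kSL2 kSL2_scaleAr.

(* The value f(x) of a regular function at a point x with \det x = 1. *)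
Definition ev (A : comAlgType k) (x : 'M[A]_2) (f : kSL2) : A :=
  mx_eval x (repr f).

Definition univ_pt : 'M[kSL2]_2 := map_mx kSL2_pi gen_mx.

Lemma det_univ_pt : \det univ_pt = 1.
Proof.
rewrite det_map_mx -(rmorph1 kSL2_pi); apply/eqP.
by rewrite /kSL2_pi -Quotient.idealrBE; apply/asboolP; exists 1; rewrite mul1r.
Qed.

Lemma ev_pi (A : comAlgType k) (x : 'M[A]_2) q :
  \det x = 1 -> ev x (kSL2_pi q) = mx_eval x q.
Proof.
move=> dx; apply/eqP; rewrite -subr_eq0 -rmorphB; apply/eqP.
apply: det_ideal_eval => //.
by rewrite Quotient.idealrBE reprK.
Qed.

Lemma pi_repr (f : kSL2) : kSL2_pi (repr f) = f.
Proof. exact: reprK. Qed.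

Fact ev_linear (A : comAlgType k) (x : 'M[A]_2) : \det x = 1 -> linear (ev x).
Proof.
move=> dx c f g; rewrite -(pi_repr f) -(pi_repr g).
rewrite -[c *: _]rmorphM -rmorphD !ev_pi // rmorphD rmorphM /=.
by rewrite mx_evalC mulr_algl.
Qed.

Lemma ev_linearZ (A : comAlgType k) (x : 'M[A]_2) (dx : \det x = 1) c (f : kSL2) :
  ev x (c *: f) = c *: ev x f.
Proof. exact: (GRing.scalable_linear (ev_linear dx)). Qed.

Fact ev_monoid (A : comAlgType k) (x : 'M[A]_2) : \det x = 1 -> monoid_morphism (ev x).
Proof.
move=> dx; split=> [|f g]; first by rewrite -(rmorph1 kSL2_pi) ev_pi // rmorph1.
by rewrite -(pi_repr f) -(pi_repr g) -rmorphM !ev_pi // rmorphM.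
Qed.

Definition ev_lrmorphism (A : comAlgType k) (x : 'M[A]_2) (dx : \det x = 1) :
    {lrmorphism kSL2 -> A} :=
  HB.pack (ev x) (GRing.isLinear.Build k kSL2 A *:%R (ev x) (ev_linear dx))
    (GRing.isMonoidMorphism.Build kSL2 A (ev x) (ev_monoid dx)).

Lemma ev_map (A B : comAlgType k) (f : {lrmorphism A -> B}) (x : 'M[A]_2) q :
  f (ev x q) = ev (map_mx f x) q.
Proof. exact: mx_eval_map. Qed.

Lemma ev_univ_pt q : ev univ_pt q = q.
Proof.
rewrite -[q in RHS]pi_repr /ev; move: (repr q) => {}q.
rewrite /mx_eval /mmap [in RHS](mpolyE q) rmorph_sum; apply: eq_bigr => m _ /=.
rewrite -mul_mpolyC rmorphM mpolyXE_id rmorph_prod /=; congr (_ * _).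
  by rewrite -[LHS]/(kSL2_pi _ * 1) mulr1.
apply: eq_bigr => i _; rewrite rmorphXn; congr (_ ^+ _).
by case/mxvec_indexP: i => i j; rewrite mxvecE !mxE.
Qed.

End CoordinateRing.

Section LeftTranslation.
Variable k : fieldType.
Local Notation O := (kSL2 k).

(* (g f)(x) = f(g^-1 x), computed at the universal point x of k[SL_2] ⊗ A. *)
Definition left_act (A : comAlgType k) (g : 'M[A]_2) (f : O) : tensor O A :=
  ev (map_mx (tensr O) (\adj g) *m map_mx (tensl A) (univ_pt k)) f.

Definition left_data := @ModuleData k O left_act.

Lemma det_left (A : comAlgType k) (g : 'M[A]_2) : \det g = 1 ->
  \det (map_mx (tensr O) (\adj g) *m map_mx (tensl A) (univ_pt k)) = 1.
Proof.
move=> dg; rewrite det_mulmx det_map_mx det_adj // rmorph1 mul1r.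
by rewrite det_map_mx det_univ_pt rmorph1.
Qed.

Lemma tprod_left (A C : comAlgType k) (x : 'M[C]_2) (dx : \det x = 1)
    (h : {lrmorphism A -> C}) (g : 'M[A]_2) f :
  tprod (ev_lrmorphism dx) h (left_act g f) = ev (map_mx h (\adj g) *m x) f.
Proof.
rewrite /left_act ev_map map_mxM; congr (ev (_ *m _) f); apply/matrixP => i j.
  by rewrite !mxE; exact: tprodr.
rewrite mxE [in LHS]mxE [LHS]tprodl /=.
by rewrite -[RHS](congr1 (fun M : 'M[C]_2 => M i j) (mx_eval_gen x)) !mxE ev_pi // !mxE.
Qed.

Fact left_rational : is_rational (SL2 k) left_data.
Proof.
have lin (A : comAlgType k) (g : 'M[A]_2) : \det g = 1 -> linear (@left_act A g).
  by move=> dg; exact: ev_linear (det_left dg).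
split=> //=.
- move=> A f; rewrite /left_act adj1 map_mx1 mul1mx -ev_map ev_univ_pt //.
- move=> A g h dg dh f.
  have E t : aext (left_act g) t =
             tprod (ev_lrmorphism (det_left dg)) (tensr O) t.
    elim/tensor_ind: t => [|x y hx hy|q a].
    + by rewrite aext0 ?linear0 //; exact: lin.
    + by rewrite aextD ?linearD ?hx ?hy //; exact: lin.
    rewrite aextE; last exact: lin.
    rewrite tprodE /= -/(left_act g q).
    elim/tensor_ind: (left_act g q) => [|x y hx hy|f' b].
    + by rewrite linear0 mul0r.
    + by rewrite [LHS]linearD /= hx hy mulrDl.
    by rewrite amulE tensM mulr1 mulrC.
  rewrite E (tprod_left (det_left dg)) /left_act (adjM dg dh).
  by rewrite (map_mxM (tensr O) (\adj h) (\adj g)) -mulmxA.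
- move=> A B f g dg q.
  have E t : tmap (idfun : {linear O -> O}) f t
           = tprod (tensl B) (tensr O \o f) t.
    apply: (eq_tensor (f := tmap idfun f) (g := tprod _ _)) => u a /=.
    by rewrite tmapE tprodE /= tenslr.
  rewrite E /left_act ev_map map_mxM -map_mx_adj.
  congr (ev (_ *m _) q); apply/matrixP => i j; rewrite !mxE.
    by rewrite [RHS]tprodr.
  by rewrite [RHS]tprodl.
Qed.

Definition left_regular : rmodule (SL2 k) := RModule left_rational.

Variable H : sl2_subgroup k.

Definition right_invariant (f : O) : Prop :=
  forall (A : comAlgType k) (x n : 'M[A]_2),
    \det x = 1 -> H A n -> ev (x *m n) f = ev x f.

Definition kG_mod_pred : {pred O} := fun f => `[< right_invariant f >].

Fact kG_mod_closed : submod_closed kG_mod_pred.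
Proof.
have dxn (A : comAlgType k) (x n : 'M[A]_2) :
    \det x = 1 -> H A n -> \det (x *m n) = 1.
  by move=> dx /pts_det dn; rewrite det_mulmx dx dn mulr1.
split=> [|c f g /asboolP hf /asboolP hg]; apply/asboolP => A x n dx Hn.
  exact: etrans (linear0 (ev_lrmorphism (dxn _ _ _ dx Hn)))
                (esym (linear0 (ev_lrmorphism dx))).
rewrite (ev_linear dx) -(hf A x n) // -(hg A x n) //.
exact: (ev_linear (dxn _ _ _ dx Hn)).
Qed.
HB.instance Definition _ := GRing.isSubmodClosed.Build k O kG_mod_pred kG_mod_closed.

End LeftTranslation.

Section HomogeneousSpace.
Variables (k : fieldType) (H : sl2_subgroup k).
Local Notation O := (kSL2 k).

(* k[SL_2/H]: the regular functions on SL_2 that are invariant under right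
   translation by H. *)
Record kG_mod := KGMod { kG_mod_val :> O; _ : kG_mod_val \in kG_mod_pred H }.
HB.instance Definition _ := [isSub for kG_mod_val].
HB.instance Definition _ := [Choice of kG_mod by <:].
HB.instance Definition _ := [SubChoice_isSubLmodule of kG_mod by <:].

Lemma slice_left_invariant (A : comAlgType k) (g : 'M[A]_2) (f : O)
    (l : {linear A -> k^o}) :
  \det g = 1 -> right_invariant H f -> right_invariant H (slice l (left_act g f)).
Proof.
move=> dg hf B x n dx Hn.
have E (y : 'M[B]_2) (dy : \det y = 1) :
    ev y (slice l (left_act g f)) =
    slice l (ev (map_mx (tensr B) (\adj g) *m map_mx (tensl A) y) f).
  have dy' : \det (map_mx (tensl A) y) = 1 by rewrite det_map_mx dy rmorph1.
  rewrite -(tprod_left dy'); move: (left_act g f) => t.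
  apply: (eq_tensor (f := ev_lrmorphism dy \o slice l)
            (g := slice l \o tprod (ev_lrmorphism dy') (tensr B))) => q a /=.
  by rewrite tprodE /= -ev_map tenslr !sliceE [LHS](ev_linearZ dy).
have dxn : \det (x *m n) = 1 by rewrite det_mulmx dx (pts_det Hn) mulr1.
rewrite (E _ dxn) (E _ dx) (map_mxM (tensl A) x n) mulmxA.
set y := _ *m map_mx (tensl A) x.
have dy : \det y = 1.
  rewrite det_mulmx det_map_mx det_adj // rmorph1 mul1r.
  by rewrite det_map_mx dx rmorph1.
exact: congr1 (hf _ y _ dy (pts_map (tensl A) Hn)).
Qed.

Fact kG_mod_stable (A : comAlgType k) (g : 'M[A]_2) : SL2 k A g ->
  forall f : kG_mod, exists t, tmap (\val : {linear kG_mod -> O}) idfun t = left_act g (\val f).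
Proof.
move=> dg [f /= Hf].
have sub : subspace (fun f : O => f \in kG_mod_pred H).
  by split=> [|c u v hu hv]; [exact: rpred0|rewrite rpredD ?rpredZ].
have [l|s -> Hs] := tensor_slice (t := left_act g f) sub.
  by apply/asboolP; apply: slice_left_invariant => //; exact/asboolP.
exists (\sum_(p <- s) tens (insubd (0 : kG_mod) p.1) p.2).
rewrite linear_sum big_seq [RHS]big_seq; apply: eq_bigr => p /Hs Hp /=.
by rewrite tmapE /= val_insubd Hp.
Qed.

Definition kG_mod_rep : rmodule (SL2 k) :=
  submodule (M := left_regular k) val_inj kG_mod_stable.

End HomogeneousSpace.

Definition kGN (k : fieldType) : rmodule (SL2 k) := kG_mod_rep (normalizer (torus k)).

Section Injective.
Variables (k : fieldType) (H : sl2_subgroup k).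

Definition injective_module (I : rmodule H) : Prop :=
  forall (M N : rmodule H) (i : rhom H M N) (f : rhom H M I),
    injective i -> exists h : rhom H N I, forall m, h (i m) = f m.

Record injective_resolution (M : rmodule H) := InjectiveResolution {
  res_obj :> nat -> rmodule H;
  res_inj : forall n, injective_module (res_obj n);
  res_aug : rhom H M (res_obj 0);
  res_d : forall n, rhom H (res_obj n) (res_obj n.+1);
  res_aug_inj : injective res_aug;
  res_exact0 : forall x, res_d 0 x = 0 <-> exists m, x = res_aug m;
  res_exactS : forall n x, res_d n.+1 x = 0 <-> exists y, x = res_d n y
}.

End Injective.

Section Cohomology.
Variables (k : fieldType) (H : sl2_subgroup k) (M : rmodule H).
Variable I : injective_resolution M.

Lemma invariant0 (V : rmodule H) : invariant H (0 : V).
Proof.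
move=> A g Hg; rewrite tens0l.
have h := act_linear (rmoduleP V) Hg; have := h (-1) 0 0.
by rewrite scaler0 addr0 scaleN1r addNr.
Qed.

Lemma invariantP (V : rmodule H) c (x y : V) :
  invariant H x -> invariant H y -> invariant H (c *: x + y).
Proof.
move=> hx hy A g Hg; rewrite (act_linear (rmoduleP V) Hg) hx // hy //.
by rewrite tensDl tensZl.
Qed.

(* Cocycles and coboundaries are those of the complex of H-invariants of I. *)
Definition cocycle n : {pred I n} := fun x => `[< invariant H x /\ res_d I n x = 0 >].

Fact cocycle_closed n : submod_closed (@cocycle n).
Proof.
split=> [|c x y /asboolP[hx dx] /asboolP[hy dy]]; apply/asboolP; split.
- exact: invariant0.
- exact: linear0.
- exact: invariantP.
- by rewrite linearP dx dy scaler0 addr0.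
Qed.
HB.instance Definition _ n :=
  GRing.isSubmodClosed.Build k (I n) (@cocycle n) (@cocycle_closed n).

Record cocycles n := Cocycle { cocycle_val :> I n; _ : cocycle_val \in @cocycle n }.
HB.instance Definition _ n := [isSub for @cocycle_val n].
HB.instance Definition _ n := [Choice of cocycles n by <:].
HB.instance Definition _ n := [SubChoice_isSubLmodule of cocycles n by <:].

Definition is_coboundary n : I n -> Prop :=
  match n with
  | 0 => fun x => x = 0
  | n'.+1 => fun x => exists2 y : I n', invariant H y & x = res_d I n' y
  end.

Definition coboundary n : {pred cocycles n} := fun z => `[< @is_coboundary n z >].

Fact coboundary_closed n : submod_closed (@coboundary n).
Proof.
case: n => [|n]; split=> [|c x y /asboolP hx /asboolP hy]; apply/asboolP => //=.
- by rewrite /= hx hy scaler0 addr0.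
- by exists 0; rewrite ?linear0 //; exact: invariant0.
case: hx hy => [x' ix ->] [y' iy ->]; exists (c *: x' + y'); rewrite ?linearP //.
exact: invariantP.
Qed.
HB.instance Definition _ n :=
  GRing.isSubmodClosed.Build k (cocycles n) (@coboundary n) (@coboundary_closed n).

(* The n-th right derived functor of M |-> M^H, computed from the injective
   resolution I of M. *)
Definition cohomology n := Quotient.quot (@coboundary n).
HB.instance Definition _ n := GRing.Zmodule.on (cohomology n).

Definition class n : cocycles n -> cohomology n := \pi_(Quotient.quot (@coboundary n)).
HB.instance Definition _ n := GRing.Additive.on (@class n).

Lemma class_eq n (x y : cocycles n) :
  (class x = class y) <-> is_coboundary (\val (x - y)).
Proof.
split=> [/eqP|h]; last apply/eqP; rewrite -Quotient.idealrBE.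
  by move=> /asboolP.
exact/asboolP.
Qed.

Lemma class_repr n (x : cohomology n) : class (repr x) = x.
Proof. exact: reprK. Qed.

Definition cohomology_scale n (c : k) (x : cohomology n) : cohomology n :=
  class (c *: repr x).

Fact class_scale n c (z : cocycles n) : cohomology_scale c (class z) = class (c *: z).
Proof.
apply/class_eq; have /class_eq := class_repr (class z).
have hz (u v : cocycles n) : u - v \in @coboundary n -> c *: u - c *: v \in @coboundary n.
  by rewrite -scalerBr; exact: rpredZ.
by move=> h; have /asboolP := hz _ _ (introT (asboolP _) h).
Qed.

Fact cohomology_scaleA n a b (x : cohomology n) :
  cohomology_scale a (cohomology_scale b x) = cohomology_scale (a * b) x.
Proof. by rewrite -(class_repr x) !class_scale scalerA. Qed.
Fact cohomology_scale1 n : left_id 1 (@cohomology_scale n).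
Proof. by move=> x; rewrite -(class_repr x) class_scale scale1r. Qed.
Fact cohomology_scaleDr n : right_distributive (@cohomology_scale n) +%R.
Proof.
move=> c x y; rewrite -(class_repr x) -(class_repr y) -raddfD !class_scale.
by rewrite scalerDr raddfD.
Qed.
Fact cohomology_scaleDl n (x : cohomology n) :
  {morph (@cohomology_scale n)^~ x : a b / a + b}.
Proof. by move=> a b; rewrite -(class_repr x) !class_scale scalerDl raddfD. Qed.
HB.instance Definition _ n := GRing.Zmodule_isLmodule.Build k (cohomology n)
  (@cohomology_scaleA n) (@cohomology_scale1 n) (@cohomology_scaleDr n)
  (@cohomology_scaleDl n).

End Cohomology.

Section Restriction.
Variables (k : fieldType) (H' H : sl2_subgroup k) (le : sub_le H' H).
Variables (M : rmodule H) (M' : rmodule H').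
Variables (I : injective_resolution M) (J : injective_resolution M').

(* A morphism of complexes of H'-modules I -> J lifting f : M -> M'. *)
Record lift_of (f : rhom H' M M') := LiftOf {
  lift_fun :> forall n, rhom H' (I n) (J n);
  lift_aug : forall m, lift_fun 0 (res_aug I m) = res_aug J (f m);
  lift_d : forall n x, lift_fun n.+1 (res_d I n x) = res_d J n (lift_fun n x)
}.

Variables (f : rhom H' M M') (phi : lift_of f).

Lemma rhom_invariant (V W : module_data k) (h : rhom H' V W) v :
  invariant H v -> invariant H' (h v).
Proof.
by move=> iv A g H'g; rewrite -(rhomP h H'g) (iv _ _ (le H'g)) tmapE.
Qed.

Fact lift_cocycle n (z : cocycles I n) : phi n (cocycle_val z) \in @cocycle _ _ _ J n.
Proof.
case: z => z /= /asboolP[iz dz]; apply/asboolP; split; first exact: rhom_invariant.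
by rewrite -lift_d dz linear0.
Qed.

Definition cocycle_map n (z : cocycles I n) : cocycles J n := Cocycle (@lift_cocycle n z).

(* For H' <= H, M' = M and f = id this is the restriction map
   H^n(H, M) -> H^n(H', M). *)
Definition cohomology_map n (x : cohomology I n) : cohomology J n :=
  class (cocycle_map (repr x)).

Lemma cohomology_mapE n (z : cocycles I n) :
  cohomology_map (class z) = class (cocycle_map z).
Proof.
apply/class_eq.
have /class_eq : class (repr (class z)) = class z by exact: reprK.
move: (repr _) => z'; case: n z z' => [|n] z z' /=.
  by rewrite -linearB => ->; rewrite linear0.
case=> y iy e; exists (phi n y); first exact: rhom_invariant.
by rewrite -lift_d -e linearB.
Qed.

Fact cohomology_map_linear n : linear (@cohomology_map n).
Proof.
move=> c x y; rewrite -(class_repr x) -(class_repr y).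
rewrite -[c *: class _]/(cohomology_scale _ _) class_scale -raddfD !cohomology_mapE.
rewrite -[c *: class _]/(cohomology_scale _ _) class_scale -raddfD.
by congr class; apply: val_inj; rewrite /= linearP.
Qed.
HB.instance Definition _ n := GRing.isLinear.Build k (cohomology I n) (cohomology J n)
  *:%R (@cohomology_map n) (@cohomology_map_linear n).

End Restriction.

Section RHomExtra.
Variable k : fieldType.

Definition rhom_id (H : sl2_subgroup k) (M : module_data k) : rhom H M M :=
  RHom (rhom_fun := idfun) (fun A g _ m => tmap_id (mact g m)).

Lemma tmap_comp (M M' M'' A : lmodType k) (g : {linear M' -> M''})
    (f : {linear M -> M'}) (t : tensor M A) :
  tmap g idfun (tmap f (idfun : {linear A -> A}) t) = tmap (g \o f) idfun t.
Proof.
apply: (eq_tensor (f := tmap g idfun \o tmap f idfun) (g := tmap (g \o f) idfun)).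
by move=> m a /=; rewrite !tmapE.
Qed.

Lemma eq_tmap (M M' A : lmodType k) (f f' : {linear M -> M'}) (t : tensor M A) :
  f =1 f' -> tmap f (idfun : {linear A -> A}) t = tmap f' idfun t.
Proof.
move=> e; apply: (eq_tensor (f := tmap f idfun) (g := tmap f' idfun)) => m a /=.
by rewrite !tmapE e.
Qed.

Definition rhom_comp (H' H : sl2_subgroup k) (le : sub_le H' H) (M M' M'' : module_data k)
    (g : rhom H' M' M'') (f : rhom H M M') : rhom H' M M''.
Proof.
refine (@RHom k H' M M'' (g \o f) _) => A x Hx m.
by rewrite -tmap_comp (rhomP f (le _ _ Hx)) (rhomP g Hx).
Defined.

End RHomExtra.

Section LiftUnique.
Variables (k : fieldType) (H' H : sl2_subgroup k) (le : sub_le H' H).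
Variables (M : rmodule H) (M' : rmodule H').
Variables (I : injective_resolution M) (J : injective_resolution M').
Variables (f : rhom H' M M') (phi phi' : lift_of I J f).

Definition im_d0 : {pred I 1} := fun z => `[< exists y, z = res_d I 0 y >].

Fact im_d0_closed : submod_closed im_d0.
Proof.
split=> [|c x y /asboolP[x' ->] /asboolP[y' ->]]; apply/asboolP.
  by exists 0; rewrite linear0.
by exists (c *: x' + y'); rewrite linearP.
Qed.
HB.instance Definition _ := GRing.isSubmodClosed.Build k (I 1) im_d0 im_d0_closed.

Record im_d0_type := ImD0 { im_d0_val :> I 1; _ : im_d0_val \in im_d0 }.
HB.instance Definition _ := [isSub for im_d0_val].
HB.instance Definition _ := [Choice of im_d0_type by <:].
HB.instance Definition _ := [SubChoice_isSubLmodule of im_d0_type by <:].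

Fact im_d0_mem y : res_d I 0 y \in im_d0.
Proof. by apply/asboolP; exists y. Qed.

Definition corestr (y : I 0) : im_d0_type := ImD0 (im_d0_mem y).
Fact corestr_linear : linear corestr.
Proof. by move=> c x y; apply: val_inj; rewrite /= linearP. Qed.
HB.instance Definition _ := GRing.isLinear.Build k (I 0) im_d0_type *:%R corestr corestr_linear.

Local Notation ival := (\val : {linear im_d0_type -> I 1}).

Fact corestr_act (A : comAlgType k) (g : 'M[A]_2) y : H' A g ->
  tmap ival idfun (tmap corestr idfun (mact g y)) = mact g (ival (corestr y)).
Proof.
move=> Hg; rewrite tmap_comp -(rhomP (res_d I 0) (le Hg)).
exact: eq_tmap.
Qed.

Fact im_d0_surj (z : im_d0_type) : exists y, z = corestr y.
Proof.
by case: z => z hz; have /asboolP[y e] := hz; exists y; apply: val_inj.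
Qed.

Fact im_d0_stable (A : comAlgType k) (g : 'M[A]_2) : H' A g ->
  forall z, exists t, tmap ival idfun t = mact g (ival z).
Proof.
move=> Hg z; have [y ->] := im_d0_surj z.
by exists (tmap corestr idfun (mact g y)); exact: corestr_act.
Qed.

Definition im_d0_rep : rmodule H' :=
  submodule (M := restrict le (I 1)) (i := ival) val_inj im_d0_stable.

Let del (y : I 0) : J 0 := phi 0 y - phi' 0 y.

Fact del_linear : linear del.
Proof.
by move=> c x y; rewrite /del (linearP (phi 0)) (linearP (phi' 0)) opprD addrACA scalerBr.
Qed.

Let delL : {linear I 0 -> J 0} :=
  HB.pack del (GRing.isLinear.Build k (I 0) (J 0) *:%R del del_linear).

Fact del_act (A : comAlgType k) (g : 'M[A]_2) y : H' A g ->
  tmap delL idfun (mact g y) = mact g (del y).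
Proof.
move=> Hg; have lin := act_linear (rmoduleP (J 0)) Hg.
have -> : mact g (del y) = mact g (phi 0 y) - mact g (phi' 0 y).
  rewrite /del addrC -scaleN1r [LHS]lin scaleN1r addrC //.
rewrite -(rhomP (phi 0) Hg) -(rhomP (phi' 0) Hg).
elim/tensor_ind: (mact g y) => [|u v hu hv|m a].
- by rewrite !linear0 addr0.
- by rewrite !linearD /= hu hv addrACA.
by rewrite !tmapE /= /del tensDl -scaleN1r tensZl scaleN1r.
Qed.

Fact del_ker y y' : corestr y = corestr y' -> del y = del y'.
Proof.
move=> e; apply/eqP; rewrite -subr_eq0 -[_ - _](linearB delL) /=; apply/eqP.
have : res_d I 0 (y - y') = 0.
  by rewrite linearB; have /= -> := congr1 val e; rewrite subrr.
by move=> /res_exact0[m ->]; rewrite /del !lift_aug subrr.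
Qed.

Definition del_im (z : im_d0_type) : J 0 := del (projT1 (cid (im_d0_surj z))).

Fact del_imE y : del_im (corestr y) = del y.
Proof. by rewrite /del_im; case: cid => y' /= e; apply: del_ker. Qed.

Fact del_im_linear : linear del_im.
Proof.
move=> c u v; have [x ->] := im_d0_surj u; have [y ->] := im_d0_surj v.
by rewrite -linearP !del_imE del_linear.
Qed.
HB.instance Definition _ := GRing.isLinear.Build k im_d0_type (J 0) *:%R del_im del_im_linear.

Definition del_rhom : rhom H' im_d0_rep (J 0).
Proof.
refine (@RHom k H' im_d0_rep (J 0) del_im _) => A g Hg z.
have [y ->] := im_d0_surj z; rewrite [RHS](congr1 (mact g) (del_imE y)) -del_act //.
have -> : @mact _ im_d0_rep A g (corestr y) = tmap corestr idfun (mact g y).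
  apply: (@tmap_inj _ _ _ A ival val_inj); rewrite corestr_act //.
  exact: (sub_actE (M := restrict le (I 1)) im_d0_stable _ Hg).
by rewrite tmap_comp; apply: eq_tmap => x /=; rewrite del_imE.
Defined.

Definition val_rhom : rhom H' im_d0_rep (restrict le (I 1)).
Proof.
refine (@RHom k H' im_d0_rep (I 1) ival _) => A g Hg z.
exact: (sub_actE (M := restrict le (I 1)) im_d0_stable _ Hg).
Defined.

(* The map induced in degree 1 does not depend on the choice of the lift. *)
Lemma cohomology_map_unique :
  @cohomology_map _ _ _ le _ _ I J f phi 1 =1 @cohomology_map _ _ _ le _ _ I J f phi' 1.
Proof.
have [s sE] := @res_inj _ _ _ J 0 _ _ val_rhom del_rhom val_inj.
move=> x; rewrite -(class_repr x) !cohomology_mapE; move: (repr x) => {x} [z hz].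
have /asboolP[iz dz] := hz; apply/class_eq.
have [y e] := (@res_exactS _ _ _ I 0 z).1 dz.
exists (s z); first exact: (rhom_invariant le s iz).
have -> : s z = del y by rewrite -del_imE -[RHS]sE /= -e.
by rewrite /= /del e !lift_d linearB.
Qed.

End LiftUnique.

Section Composition.
Variables (k : fieldType) (H'' H' H : sl2_subgroup k).
Variables (le : sub_le H' H) (le' : sub_le H'' H') (le'' : sub_le H'' H).
Variables (M : rmodule H) (M' : rmodule H') (M'' : rmodule H'').
Variables (I : injective_resolution M) (J : injective_resolution M').
Variables (K : injective_resolution M'').
Variables (f : rhom H' M M') (g : rhom H'' M' M'') (h : rhom H'' M M'').
Hypothesis gf : forall m, h m = g (f m).
Variables (phi : lift_of I J f) (psi : lift_of J K g).

Definition lift_comp : lift_of I K h.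
Proof.
refine (@LiftOf k H'' H M M'' I K h
  (fun n => @RHom k H'' (I n) (K n) (psi n \o phi n) _) _ _) => /=.
- by move=> m; rewrite !lift_aug gf.
- by move=> n x; rewrite !lift_d.
Unshelve.
move=> A x Hx m; rewrite -tmap_comp (rhomP (phi n) (le' Hx)); exact: (rhomP (psi n) Hx).
Defined.

Lemma cohomology_map_comp (chi : lift_of I K h) x :
  cohomology_map le' psi (cohomology_map le phi x) = cohomology_map le'' chi x :> cohomology K 1.
Proof.
rewrite -(cohomology_map_unique le'' lift_comp chi) -(class_repr x).
by rewrite !cohomology_mapE; congr class; apply: val_inj.
Qed.

End Composition.

Definition inverse_limit (X : nat -> Type) (t : forall r, X r.+1 -> X r) : Type :=
  {x : forall r, X r | forall r, t r (x r.+1) = x r}.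

(* Here G_r is frobker hp r; the index r of J, phi and psi is shifted by one, so
   that the limit is over the G_r with r >= 1. *)
Section CanonicalMap.
Variables (k : fieldType) (p : nat) (hp : p \in [pchar k]) (M : rmodule (SL2 k)).

Definition restrict_frob (r : nat) : rmodule (frobker hp r) :=
  restrict (@frobker_le_SL2 k p hp r) M.

Variables (I : injective_resolution M).
Variables (J : forall r, injective_resolution (restrict_frob r.+1)).
Variable phi : forall r, lift_of I (J r) (rhom_id (frobker hp r.+1) M).
Variable psi : forall r, lift_of (J r.+1) (J r) (rhom_id (frobker hp r.+1) M).

Definition res_SL2 r : cohomology I 1 -> cohomology (J r) 1 :=
  @cohomology_map _ _ _ (@frobker_le_SL2 k p hp r.+1) _ _ _ _ _ (phi r) 1.

Definition res_frob r : cohomology (J r.+1) 1 -> cohomology (J r) 1 :=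
  @cohomology_map _ _ _ (@frobker_leS k p hp r.+1) _ _ _ _ _ (psi r) 1.

Fact res_compatible x r : res_frob (res_SL2 r.+1 x) = res_SL2 r x.
Proof. exact: cohomology_map_comp. Qed.

Definition to_limit (x : cohomology I 1) : inverse_limit res_frob :=
  exist _ (res_SL2^~ x) (res_compatible x).

End CanonicalMap.

(* Main.v *)
From mathcomp Require Import all_boot all_order all_algebra.
From mathcomp Require Import boolp ring.
Require Import Defs.

(** The canonical map is not injective.  Write a, b, c, d for the matrix entries
    on SL_2 and let f = ad in k[SL_2].

    Right translation by the Weyl element exchanges ad and bc up to sign, and
    ad - bc = 1; so in characteristic 2 it sends f to f + 1, whereas T fixes f.
    More precisely a point n of N over A satisfies f(xn) = f(x) + e for an
    idempotent e of A that depends on n alone ([diag_prod_normalizer]).  Thus f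
    is not in k[G/N], but g f - f is for every g in G ([diag_prod_left]): the
    span of k[G/N] and f inside k[G] is an extension of k by k[G/N], and it
    defines a class c in H^1(G, k[G/N]).

    - Over G the class is nonzero.  If it vanished, f - m would be G-invariant
      for some m in k[G/N], hence take the same value at the identity and at
      the Weyl element; as m does so too, f would, although f is 1 at the
      identity and 0 at the Weyl element ([diag_prod_not_invariant]).
    - Over G_r the class vanishes.  With q = 2^r the function f^q is invariant
      under left translation by G_r, and f - f^q lies in k[G/N] because e^q = e
      ([diag_prod_frob_invariant], [diag_prod_sub_frob]).

    Lemma [connecting_class] translates this into the cohomology of an
    arbitrary injective resolution: the class attached to f is zero on a
    subgroup as soon as some f - m is invariant under it, and over G only
    then. *)

Set Implicit Arguments.
Unset Strict Implicit.
Unset Printing Implicit Defensive.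

Import GRing.Theory.
Local Open Scope ring_scope.

(** * Matrices of size 2 *)

Section TwoByTwo.
Variable A : comNzRingType.
Implicit Types x y : 'M[A]_2.

Lemma mulmx2E m n (x : 'M[A]_(m, 2)) (y : 'M[A]_(2, n)) i j :
  (x *m y) i j = x i 0 * y 0 j + x i 1 * y 1 j.
Proof.
by rewrite mxE !big_ord_recl big_ord0 addr0; congr (_ * _ + x i _ * y _ j); exact: val_inj.
Qed.

Lemma det2E x : \det x = x 0 0 * x 1 1 - x 0 1 * x 1 0.
Proof.
rewrite (expand_det_row x 0) !big_ord_recl big_ord0 addr0.
rewrite /cofactor !det_mx11 !mxE /= expr0 expr1 mul1r mulN1r mulrN.
by congr (_ * x _ _ - x _ _ * x _ _); exact: val_inj.
Qed.

Lemma adj2E x :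
  ((\adj x) 0 0 = x 1 1) * ((\adj x) 0 1 = - x 0 1) *
  ((\adj x) 1 0 = - x 1 0) * ((\adj x) 1 1 = x 0 0).
Proof.
rewrite ![(\adj x) _ _]mxE /cofactor !det_mx11 !mxE /=.
rewrite expr0 expr1 sqrrN expr1n !mul1r !mulN1r.
by do !split; congr (x _ _) || congr (- x _ _); apply: val_inj.
Qed.

End TwoByTwo.

(** * Points of the normalizer of the torus *)

Section Normalizer.
Variable k : fieldType.

Lemma tensl_inj (A B : comAlgType k) : injective (@tensl k A B).
Proof.
have s0 : subspace (fun b : B => b = 0).
  by split=> // c u v -> ->; rewrite scaler0 addr0.
have [l [l1 _]] := linear_functional s0 (elimN eqP (oner_neq0 B)).
by move=> a a' /(congr1 (slice l)); rewrite !sliceE l1 !scale1r.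
Qed.

(** A point n of the normalizer is tested on diag(u, u^-1): the off-diagonal
    entries of its conjugate are multiples of u - u^-1.  The field k may be too
    small to contain a u for which this is a unit, but k[u]/(u^2 - u - 1) has
    one, with u - u^-1 = 1. *)
Lemma golden_unit : exists (Q : comAlgType k) (u : Q), u * (u - 1) = 1.
Proof.
pose h : {poly k} := 'X^2 - ('X + 1).
have sl : (size ('X + 1 : {poly k})%R < size ('X^2 : {poly k})%R)%N.
  by rewrite size_polyXn size_XaddC.
have hm : h \is monic by rewrite monicE lead_coefDl ?size_polyN // lead_coefXn.
have sh : size h = 3 by rewrite size_polyDl ?size_polyN // size_polyXn.
exists {poly %/ h}, (qpolyX h); apply/eqP; rewrite -subr_eq0; apply/eqP.
have -> : qpolyX h * (qpolyX h - 1) - 1 = in_qpoly h h.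
  rewrite [in RHS]/h !rmorphB rmorphD rmorphXn rmorph1 /= -/(qpolyX h); ring.
by apply: val_inj; rewrite /= /mk_monic sh hm Pdiv.RingMonic.rmodpp.
Qed.

Lemma normalizer_torus_monomial (A : comAlgType k) (n : 'M[A]_2) :
  normalizer (torus k) A n -> n 0 0 * n 0 1 = 0 /\ n 1 0 * n 1 1 = 0.
Proof.
case=> dn nn; have [Q [u uE]] := golden_unit.
pose w : tensor A Q := tensr A u.
have wE : w * (w - 1) = 1.
  by rewrite -[1](rmorph1 (tensr A)) -rmorphB -rmorphM uE.
pose t : 'M[tensor A Q]_2 := \matrix_(i, j) (if i == j then if i == 0 then w else w - 1 else 0).
have dt : \det t = 1 by rewrite det2E !mxE /= wE mulr0 subr0.
have td : is_diag_mx t.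
  by apply/is_diag_mxP => i j; rewrite mxE -val_eqE => /negbTE ->.
have [_ /is_diag_mxP d] := (nn _ (tensl Q) t dt).1 (conj dt td).
split; apply: (@tensl_inj A Q); rewrite rmorph0 rmorphM /=.
  apply: oppr_inj; rewrite oppr0.
  by have := d 0 1 isT; rewrite !mulmx2E !adj2E !mxE /= => <-; ring.
by have := d 1 0 isT; rewrite !mulmx2E !adj2E !mxE /= => <-; ring.
Qed.

(** The Weyl element, with a sign that gives it determinant 1 over every
    ring. *)
Definition weyl_mx (A : comNzRingType) : 'M[A]_2 :=
  \matrix_(i, j) if i == j then 0 else if i == 0 then 1 else -1.

Lemma det_weyl (A : comNzRingType) : \det (weyl_mx A) = 1.
Proof. by rewrite det2E !mxE /= mul0r mul1r opprK add0r. Qed.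

Lemma is_diag2E (A : comNzRingType) (t : 'M[A]_2) :
  is_diag_mx t <-> t 0 1 = 0 /\ t 1 0 = 0.
Proof.
split=> [/is_diag_mxP h|[h01 h10]]; first by rewrite !h.
by apply/is_diag_mxP; case=> [[|[|//]] i] [[|[|//]] j] // _;
  [rewrite -[RHS]h01|rewrite -[RHS]h10]; congr (t _ _); apply: val_inj.
Qed.

Lemma weyl_normalizer (A : comAlgType k) : normalizer (torus k) A (weyl_mx A).
Proof.
split=> [|B f t dt]; first exact: det_weyl.
have -> : map_mx f (weyl_mx A) = weyl_mx B.
  apply/matrixP => i j; rewrite !mxE.
  by case: ifP => _; [exact: rmorph0|case: ifP => _; rewrite ?rmorphN1 ?rmorph1].
rewrite /= !det_mulmx det_adj ?det_weyl // dt !mulr1.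
rewrite !is_diag2E !mulmx2E !adj2E !mxE /=.
have -> : (0 * t 0 0 + 1 * t 1 0) * -1 + (0 * t 0 1 + 1 * t 1 1) * 0 = - t 1 0 by ring.
have -> : (-1 * t 0 0 + 0 * t 1 0) * 0 + (-1 * t 0 1 + 0 * t 1 1) * - -1 = - t 0 1 by ring.
split=> -[_ [h1 h2]]; do !split=> //.
- by rewrite h2 oppr0.
- by rewrite h1 oppr0.
- by apply: oppr_inj; rewrite oppr0.
- by apply: oppr_inj; rewrite oppr0.
Qed.

End Normalizer.

(** * The degree one class of an extension by the trivial module *)

Section ConnectingClass.
Variables (k : fieldType) (H : sl2_subgroup k) (M E : rmodule H).
Variables (i : rhom H M E) (e : E).
Hypothesis i_inj : injective i.
(* That is, the image of e in E / M is invariant. *)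
Hypothesis e_mod_M : forall (A : comAlgType k) (g : 'M[A]_2), H A g ->
  exists t : tensor M A, mact g e = tens e 1 + tmap i idfun t.

(** The class is the image of e mod M under the connecting map
    (E / M)^H -> H^1(H, M).  As I 0 is injective, the augmentation of M extends
    to h : E -> I 0, and the class is that of d (h e): this is invariant because
    g e - e lies in M and d kills the image of M.  Changing e by an element of M
    does not change d (h e), so the class dies wherever some e - i m is
    invariant. *)
Lemma connecting_class (I : injective_resolution M) :
  exists c : cohomology I 1,
    (c = 0 -> exists m, invariant H (e - i m : E)) /\
    forall (H' : sl2_subgroup k) (le : sub_le H' H) (M' : rmodule H')
      (J : injective_resolution M') (f : rhom H' M M') (phi : lift_of I J f) m,
      invariant H' (e - i m : E) -> cohomology_map le phi c = 0.
Proof.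
have [h hE] := @res_inj _ _ _ I 0 _ _ i (res_aug I) i_inj.
have d_aug m : res_d I 0 (res_aug I m) = 0 by apply/res_exact0; exists m.
have zP : res_d I 0 (h e) \in @cocycle _ _ _ I 1.
  apply/asboolP; split; last by apply/res_exactS; exists (h e).
  move=> A g Hg; have [t te] := e_mod_M Hg.
  rewrite -(rhomP (res_d I 0) Hg) -(rhomP h Hg) te !linearD /= !tmapE /=.
  rewrite tmap_comp tmap_comp -[RHS]addr0; congr (_ + _).
  elim/tensor_ind: t {te} => [|x y hx hy|m a]; first by rewrite linear0.
    by rewrite linearD /= hx hy addr0.
  by rewrite tmapE /= hE d_aug tens0l.
exists (class (Cocycle zP)); split.
  have -> : (0 : cohomology I 1) = class 0 by rewrite raddf0.
  move=> /class_eq; rewrite subr0 => -[/= y iy dy].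
  (* h e and the invariant y differ by the image of some m; since h is injective
     on M, although perhaps not on E, invariance of h (e - i m) can be pulled
     back to e - i m. *)
  have [m me] : exists m, h e - y = res_aug I m.
    by apply/res_exact0; rewrite linearB /= dy subrr.
  exists m => A g Hg; have [t te] := e_mod_M Hg.
  have [s se] : exists s, mact g (e - i m : E) - tens (e - i m : E) 1 = tmap i idfun s.
    exists (t - (mact g m - tens m 1)).
    have -> : mact g (e - i m : E) = mact g e - mact g (i m).
      by have := act_linear (rmoduleP E) Hg (-1) (i m) e; rewrite !scaleN1r !(addrC (- _)).
    have -> : tens (e - i m : E) (1 : A) = tens e 1 - tens (i m) 1.
      by rewrite tensDl -scaleN1r tensZl scaleN1r.
    rewrite !linearB /= (rhomP i Hg) tmapE /= te.
    by rewrite !opprK -addrA [- mact g _ + (_ + _)]addrCA addrACA subrr add0r.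
  have : tmap h idfun (tmap i idfun s) = 0.
    rewrite -se linearB /= (rhomP h Hg) tmapE /=.
    have -> : h (e - i m) = y by rewrite linearB /= hE -me opprB addrC subrK.
    by rewrite iy // subrr.
  rewrite tmap_comp (eq_tmap (f' := res_aug I)) // -(linear0 (tmap (res_aug I) idfun)).
  move=> /(tmap_inj (@res_aug_inj _ _ _ I)) s0; move/eqP: se.
  by rewrite s0 linear0 subr_eq0 => /eqP.
move=> H' le M' J f phi m im; rewrite cohomology_mapE.
rewrite -[RHS](raddf0 (@class _ _ _ J 1)); apply/class_eq; rewrite subr0 /=.
exists (phi 0 (h (e - i m))).
  exact: (rhom_invariant (H := H') (fun _ _ => id) (rhom_comp le (phi 0) h) im).
by rewrite -lift_d linearB hE [res_d _ _ (_ - _)]linearB /= d_aug subr0.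
Qed.

End ConnectingClass.

(** * Regular functions on a homogeneous space *)

Section HomogeneousSpace.
Variables (k : fieldType) (H : sl2_subgroup k).
Local Notation O := (kSL2 k).

Definition kG_mod_incl : rhom (SL2 k) (kG_mod_rep H) (left_regular k).
Proof.
refine (@RHom k (SL2 k) (kG_mod_rep H) (left_regular k)
  (\val : {linear kG_mod H -> O}) _) => A g Hg f.
exact: (sub_actE (M := left_regular k) (@kG_mod_stable k H) _ Hg).
Defined.

Lemma ev_slice (A B : comAlgType k) (y : 'M[B]_2) (dy : \det y = 1)
    (dy' : \det (map_mx (tensl A) y) = 1) (l : {linear A -> k^o}) (t : tensor O A) :
  ev y (slice l t) = slice l (tprod (ev_lrmorphism dy') (tensr B) t).
Proof.
apply: (eq_tensor (f := ev_lrmorphism dy \o slice l)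
          (g := slice l \o tprod (ev_lrmorphism dy') (tensr B))) => q a /=.
by rewrite tprodE /= -ev_map tenslr !sliceE [LHS](ev_linearZ dy).
Qed.

(** Tensoring with A commutes with the formation of k[SL_2/H]: as k is a field,
    right invariance of t can be checked on the slices of t, which lie in
    k[SL_2]. *)
Lemma kG_mod_tensor (A : comAlgType k) (t : tensor O A) :
  (forall (C : comAlgType k) (x n : 'M[C]_2) (h : {lrmorphism A -> C})
     (dx : \det x = 1) (dxn : \det (x *m n) = 1), H C n ->
     tprod (ev_lrmorphism dxn) h t = tprod (ev_lrmorphism dx) h t) ->
  exists s : tensor (kG_mod H) A, t = tmap (\val : {linear kG_mod H -> O}) idfun s.
Proof.
move=> tH.
have sub : subspace (fun f : O => f \in kG_mod_pred H).
  by split=> [|c u v hu hv]; [exact: rpred0|rewrite rpredD ?rpredZ].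
have [l|s -> Hs] := tensor_slice (t := t) sub.
  apply/asboolP => B x n dx Hn.
  have dxn : \det (x *m n) = 1 by rewrite det_mulmx dx (pts_det Hn) mulr1.
  have dl (y : 'M[B]_2) : \det y = 1 -> \det (map_mx (tensl A) y) = 1.
    by move=> dy; rewrite det_map_mx dy rmorph1.
  rewrite (ev_slice dxn (dl _ dxn)) (ev_slice dx (dl _ dx)); congr (slice l _).
  move: (dl _ dxn); rewrite (map_mxM (tensl A) x n) => d.
  exact: tH (pts_map _ Hn).
exists (\sum_(p <- s) tens (insubd (0 : kG_mod H) p.1) p.2).
rewrite linear_sum big_seq [RHS]big_seq; apply: eq_bigr => p /Hs Hp /=.
by rewrite tmapE /= val_insubd Hp.
Qed.

End HomogeneousSpace.

(** * The function ad *)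

Section DiagonalProduct.
Variable k : fieldType.
Hypothesis char2 : 2%N \in [pchar k].
Local Notation O := (kSL2 k).
Local Notation N := (normalizer (torus k)).

Definition diag_prod : O := univ_pt k 0 0 * univ_pt k 1 1.

Lemma ev_univ_entry (A : comAlgType k) (x : 'M[A]_2) i j :
  \det x = 1 -> ev x (univ_pt k i j) = x i j.
Proof.
move=> dx; rewrite -[in RHS](mx_eval_gen x) !mxE ev_pi // !mxE.
Qed.

Lemma ev_diag_prod (A : comAlgType k) (x : 'M[A]_2) :
  \det x = 1 -> ev x diag_prod = x 0 0 * x 1 1.
Proof.
by move=> dx; rewrite [LHS](rmorphM (ev_lrmorphism dx)) /= !ev_univ_entry.
Qed.

Lemma pchar2_alg (A : comAlgType k) : 2%N \in [pchar A].
Proof. by rewrite pchar_lalg. Qed.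

(** For n with entries p, q, r, s the equations pq = rs = 0 leave
    f(xn) = ad ps + bc qr, which is ad + qr in characteristic 2 because
    ps - qr = ad - bc = 1; and qr is idempotent because it is orthogonal to
    ps = 1 + qr. *)
Lemma diag_prod_normalizer (A : comAlgType k) (n : 'M[A]_2) : N A n ->
  exists2 e : A, e * e = e &
    forall x : 'M[A]_2, \det x = 1 -> ev (x *m n) diag_prod = ev x diag_prod + e.
Proof.
move=> Nn; have [n0 n1] := normalizer_torus_monomial Nn.
have dn := pts_det Nn.
exists (n 0 1 * n 1 0) => [|x dx].
  rewrite -[RHS]mulr1 -dn det2E mulrBr (oppr_pchar2 (pchar2_alg A)).
  have -> : n 0 1 * n 1 0 * (n 0 0 * n 1 1) = n 0 0 * n 0 1 * (n 1 0 * n 1 1) by ring.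
  by rewrite n0 mul0r add0r.
rewrite !ev_diag_prod ?det_mulmx ?dx ?dn ?mulr1 // !mulmx2E.
transitivity (x 0 0 * x 1 1 * \det n + n 0 1 * n 1 0 * \det x); last by rewrite dn dx !mulr1.
rewrite !det2E.
transitivity (x 0 0 * x 1 1 * (n 0 0 * n 1 1 - n 0 1 * n 1 0)
  + n 0 1 * n 1 0 * (x 0 0 * x 1 1 - x 0 1 * x 1 0)
  + (x 0 0 * x 1 0 * (n 0 0 * n 0 1) + x 0 1 * x 1 1 * (n 1 0 * n 1 1)
  + (1 + 1) * (x 0 1 * x 1 0 * (n 0 1 * n 1 0)))); first by ring.
by rewrite n0 n1 (addrr_pchar2 (pchar2_alg A)) !mulr0 mul0r !addr0.
Qed.

Lemma idem_pow (A : comAlgType k) (e : A) m : e * e = e -> e ^+ m.+1 = e.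
Proof. by move=> ee; elim: m => // m IH; rewrite exprS IH. Qed.

(** The Frobenius is additive and fixes the idempotent by which f changes under
    N, so f^q changes by the same idempotent as f. *)
Lemma diag_prod_sub_frob r : diag_prod - diag_prod ^+ (2 ^ r) \in kG_mod_pred N.
Proof.
apply/asboolP => A x n dx Nn.
have [e ee E] := diag_prod_normalizer Nn.
have dxn : \det (x *m n) = 1 by rewrite det_mulmx dx (pts_det Nn) mulr1.
rewrite [LHS](rmorphB (ev_lrmorphism dxn)) [RHS](rmorphB (ev_lrmorphism dx)).
rewrite !rmorphXn /= E //.
have := rmorphD (frob_rmorphism char2 A r) (ev x diag_prod) e.
rewrite /= /frob => ->.
by rewrite -(prednK (expn_gt0 2 r)) (idem_pow _ ee) prednK ?expn_gt0 // opprD addrACA subrr addr0.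
Qed.

(** Left and right translations commute, so right translation by n adds the same
    idempotent to g f and to f, and g f - f is right invariant under N. *)
Lemma diag_prod_left (A : comAlgType k) (g : 'M[A]_2) : \det g = 1 ->
  exists t : tensor (kGN k) A,
    left_act g diag_prod = tens diag_prod 1 + tmap (kG_mod_incl N) idfun t.
Proof.
move=> dg; have [|t E] := @kG_mod_tensor k N A (left_act g diag_prod - tens diag_prod 1).
  move=> C x n h dx dxn Nn; have [e _ E] := diag_prod_normalizer Nn.
  rewrite !rmorphB /= !tprod_left !tprodE !rmorph1 !mulr1 /= mulmxA !E //.
    by rewrite opprD addrACA subrr addr0.
  by rewrite det_mulmx det_map_mx det_adj // rmorph1 dx mulr1.
by exists t; rewrite -E addrC subrK.
Qed.

(** The q-th powers of the entries of g^-1 x are the entries of the product of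
    the Frobenius twists of g^-1 and x, and G_r is where the twist of g is
    trivial. *)
Lemma diag_prod_frob_invariant r :
  Defs.invariant (frobker char2 r) (diag_prod ^+ (2 ^ r) : left_regular k).
Proof.
move=> A g Hg; have [dg _] := Hg; rewrite /= /left_act.
set x := map_mx (tensl A) _; set y := map_mx _ _.
have dx : \det x = 1 by rewrite det_map_mx det_univ_pt rmorph1.
have dyx : \det (y *m x) = 1 := det_left dg.
have Hy : frobker char2 r _ y by apply: pts_map; apply: ptsV.
have fyx : map_mx (frob_rmorphism char2 _ r) (y *m x) = map_mx (frob_rmorphism char2 _ r) x.
  by rewrite map_mxM [map_mx _ y](proj2 Hy) mul1mx.
rewrite [LHS](rmorphXn (ev_lrmorphism dyx)) /= ev_diag_prod //.
have -> : tens (diag_prod ^+ (2 ^ r)) 1 = (ev x diag_prod) ^+ (2 ^ r) :> tensor O A.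
  rewrite -[LHS]/(tensl A _) rmorphXn; congr (_ ^+ _).
  by rewrite -[in LHS](ev_univ_pt diag_prod); exact: (ev_map (tensl A)).
rewrite ev_diag_prod // !exprMn.
have F i : (y *m x) i i ^+ (2 ^ r) = x i i ^+ (2 ^ r).
  by have := congr1 (fun M : 'M__ => M i i) fyx; rewrite !mxE.
by rewrite !F.
Qed.

Lemma diag_prod_not_invariant (m : kGN k) :
  ~ Defs.invariant (SL2 k) (diag_prod - kG_mod_incl N m : left_regular k).
Proof.
pose s := weyl_mx k^o.
have Ns : N k^o s := weyl_normalizer _.
have ds : \det s = 1 := pts_det Ns.
move=> /(_ k^o (\adj s) (det_adj ds)) /(congr1 (tprod (ev_lrmorphism (det1 k^o 2)) idfun)).
rewrite [LHS]tprod_left tprodE /= adjK // mulmx1 map_mx_id // mulr1.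
case: m => m /= /asboolP hm.
rewrite [LHS](rmorphB (ev_lrmorphism ds)) [RHS](rmorphB (ev_lrmorphism (det1 _ _))) /=.
have := hm _ 1%:M s (det1 _ _) Ns; rewrite mul1mx => ->.
move=> /addIr; rewrite !ev_diag_prod // ?det1 // !mxE /= mulr0 mulr1 => /esym/eqP.
by rewrite oner_eq0.
Qed.

End DiagonalProduct.

Theorem proposition1 (k : fieldType) (char2 : 2%N \in [pchar k])
  (I : injective_resolution (kGN k))
  (J : forall r : nat, injective_resolution (restrict_frob char2 (kGN k) r.+1))
  (phi : forall r : nat,
     lift_of I (J r) (rhom_id (frobker char2 r.+1) (kGN k)))
  (psi : forall r : nat,
     lift_of (J r.+1) (J r) (rhom_id (frobker char2 r.+1) (kGN k))) :
  ~ bijective (to_limit phi psi).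
Proof.
have [|A g dg|c [c0 cr]] :=
  @connecting_class k (SL2 k) (kGN k) (left_regular k) (kG_mod_incl _) (diag_prod k) _ _ I.
- exact: val_inj.
- exact: diag_prod_left.
move=> /bij_inj inj; case: (c0 _) => [|m]; last exact: diag_prod_not_invariant.
apply: inj; apply: eq_exist; apply: functional_extensionality_dep => r.
rewrite [RHS]linear0; apply: (cr _ _ _ _ _ _ (KGMod (diag_prod_sub_frob char2 r.+1))).
have -> : diag_prod k - kG_mod_incl _ (KGMod (diag_prod_sub_frob char2 r.+1)) = diag_prod k ^+ (2 ^ r.+1).
  by rewrite opprB addrC subrK.
exact: diag_prod_frob_invariant.
Qed.
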